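(* Assume the setting described in the context, and let $\widehat{\mathcal S}=\{j: W_j\ge T\}$, where $T$ is the knockoff+ threshold $T_+$ or the knockoff threshold $T_0$. Then: (i) (knockoff+) For every $\epsilon\ge 0$, \[\mathbb{E}\left[\frac{\big|\{j: j\in\widehat{\mathcal S}\cap \mathcal{H}_0 \text{ and } \widehat{\mathrm{KL}}_j\le \epsilon\}\big|}{|\widehat{\mathcal S}|\vee 1}\right]\le q\, e^{\epsilon},\] and consequently \[\mathrm{FDR}=\mathbb{E}\left[\frac{|\widehat{\mathcal S}\cap\mathcal H_0|}{|\widehat{\mathcal S}|\vee 1}\right]\le \min_{\epsilon\ge 0}\Big\{q\, e^{\epsilon}+\mathbb{P}\Big(\max_{j\in\mathcal H_0}\widehat{\mathrm{KL}}_j>\epsilon\Big)\Big\}.\] (ii) (knockoff) For every $\epsilon\ge 0$, \[\mathbb{E}\left[\frac{\big|\{j: j\in\widehat{\mathcal S}\cap \mathcal{H}_0 \text{ and } \widehat{\mathrm{KL}}_j\le \epsilon\}\big|}{|\widehat{\mathcal S}|+q^{-1}}\right]\le q\, e^{\epsilon},\] and consequently \[\mathbb{E}\left[\frac{|\widehat{\mathcal S}\cap\mathcal H_0|}{|\widehat{\mathcal S}|+q^{-1}}\right]\le \min_{\epsilon\ge 0}\Big\{q\, e^{\epsilon}+\mathbb{P}\Big(\max_{j\in\mathcal H_0}\widehat{\mathrm{KL}}_j>\epsilon\Big)\Big\}.\]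
   Context: Setting. $X=(X_1,\dots,X_p)$ is a random feature vector in $\mathbb{R}^p$ with (true) distribution $P_X$, and $Y\in\mathbb{R}$ is a response with an arbitrary (unknown) joint distribution with $X$. The data are $\mathbf{X}\in\mathbb{R}^{n\times p}$, $\mathbf{Y}\in\mathbb{R}^n$, whose rows $(\mathbf{X}_{i,*},\mathbf{Y}_i)$, $i=1,\dots,n$, are i.i.d. copies of $(X,Y)$. For each $j$, $X_j$ is either discrete or continuous, and $P_j(\cdot\mid x_{-j})$ denotes the true conditional probability mass function or density of $X_j$ given $X_{-j}=x_{-j}$ (here $x_{-j}$ is $x$ with the $j$th coordinate removed). For each $j$ we are given a fixed (not data-dependent) estimated conditional $Q_j(\cdot\mid x_{-j})$, a pmf/density of the same type as $P_j$ and with the same support as $P_j(\cdot\mid x_{-j})$ for every $x_{-j}$; the $Q_j$'s need not be compatible with any joint distribution. A knockoff mechanism is a conditional distribution $P_{\tilde X\mid X}(\cdot\mid x)$ on $\mathbb{R}^p$ (with $\tilde X_j$ of the same type as $X_j$). It is called pairwise exchangeable with respect to $Q_j$ if: for every distribution $D^{(j)}$ on $\mathbb{R}^p$ whose conditional distribution of $X_j$ given $X_{-j}$ is $Q_j$ (i.e. $D^{(j)}$ is an arbitrary marginal for $X_{-j}$ times $Q_j$), drawing $X\sim D^{(j)}$ and $\tilde X\mid X\sim P_{\tilde X\mid X}(\cdot\mid X)$ gives $(X_j,\tilde X_j,X_{-j},\tilde X_{-j})\overset{d}{=}(\tilde X_j,X_j,X_{-j},\tilde X_{-j})$. Standing assumption: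 $P_{\tilde X\mid X}$ is pairwise exchangeable with respect to $Q_j$ for every $j=1,\dots,p$. The knockoff matrix $\tilde{\mathbf X}\in\mathbb{R}^{n\times p}$ has rows drawn independently as $\tilde{\mathbf X}_{i,*}\sim P_{\tilde X\mid X}(\cdot\mid \mathbf X_{i,*})$, independently of $\mathbf Y$ given $\mathbf X$. Define for each $j$ \[\widehat{\mathrm{KL}}_j=\sum_{i=1}^n\log\left(\frac{P_j(\mathbf X_{ij}\mid \mathbf X_{i,-j})\,Q_j(\tilde{\mathbf X}_{ij}\mid \mathbf X_{i,-j})}{Q_j(\mathbf X_{ij}\mid \mathbf X_{i,-j})\,P_j(\tilde{\mathbf X}_{ij}\mid \mathbf X_{i,-j})}\right).\] The null set is $\mathcal H_0=\{j: X_j \text{ is independent of } Y \text{ conditionally on } X_{-j}\}$. Statistics: $W=(W_1,\dots,W_p)=w([\mathbf X,\tilde{\mathbf X}],\mathbf Y)$ for an arbitrary function $w$ with the flip-sign property: for every $A\subseteq\{1,\dots,p\}$, if $[\mathbf X,\tilde{\mathbf X}]_{\mathrm{swap}(A)}$ denotes the matrix obtained by exchanging column $\mathbf X_j$ with column $\tilde{\mathbf X}_j$ for each $j\in A$, then $w_j([\mathbf X,\tilde{\mathbf X}]_{\mathrm{swap}(A)},\mathbf Y)=w_j([\mathbf X,\tilde{\mathbf X}],\mathbf Y)$ for $j\notin A$ and $=-w_j([\mathbf X,\tilde{\mathbf X}],\mathbf Y)$ for $j\in A$. Thresholds, for a target level $q\in(0,1)$, with minima taken over $t>0$ in the set $\{|W_1|,\dots,|W_p|\}$: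 $T_0=\min\{t>0: \#\{j:W_j\le -t\}/\#\{j:W_j\ge t\}\le q\}$ (knockoff filter) and $T_+=\min\{t>0: (1+\#\{j:W_j\le -t\})/\#\{j:W_j\ge t\}\le q\}$ (knockoff+ filter). The selected set is $\widehat{\mathcal S}=\{j:W_j\ge T\}$. In expectations of ratios, $0/0$ is treated as $0$. *)

(* Defs.v *)
From HB Require Import structures.
From mathcomp Require Import all_boot all_order all_algebra.
From mathcomp Require Import all_classical all_reals all_analysis.
Set Implicit Arguments. Unset Strict Implicit. Unset Printing Implicit Defensive.
Import Order.TTheory GRing.Theory Num.Theory.
Import numFieldNormedType.Exports.
Local Open Scope classical_set_scope.
Local Open Scope ring_scope.

(* Vectors of R^p are p-tuples (with the product sigma-algebra generated by  *)
(* the coordinates).  A conditional pmf/density f(. | x_{-j}) of X_j given    *)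
(* X_{-j} is encoded as a function  f : R -> p.-tuple R -> R  that does not  *)
(* depend on the j-th coordinate of its second argument.                     *)

Definition upd (R : Type) (p : nat) (x : p.-tuple R) (j : 'I_p) (t : R)
  : p.-tuple R := [tuple if i == j then t else tnth x i | i < p].

(* reference measure on R: counting measure (pmf, discrete X_j) or Lebesgue
   measure (density, continuous X_j) *)
Definition refmeas (R : realType) (disc : bool) : set R -> \bar R :=
  if disc then @counting R R else @lebesgue_measure R.

Definition cond_pdf (R : realType) (p : nat) (nu : set R -> \bar R) (j : 'I_p)
    (f : R -> p.-tuple R -> R) : Prop :=
  [/\ measurable_fun setT (fun tx : R * p.-tuple R => f tx.1 tx.2),
      (forall t x, 0 <= f t x),
      (forall t x t', f t (upd x j t') = f t x) &
      (forall x, (\int[nu]_t (f t x)%:E = 1)%E)].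

Definition is_cond_pdf_of (R : realType) (p : nat)
    (D : set (p.-tuple R) -> \bar R) (nu : set R -> \bar R) (j : 'I_p)
    (f : R -> p.-tuple R -> R) : Prop :=
  forall A : set (p.-tuple R), measurable A ->
    D A = (\int[D]_x \int[nu]_t ((\1_A (upd x j t))%:E * (f t x)%:E))%E.

Definition swap_pair (R : Type) (p : nat) (j : 'I_p)
    (z : (p.-tuple R * p.-tuple R)%type) : (p.-tuple R * p.-tuple R)%type :=
  (upd z.1 j (tnth z.2 j), upd z.2 j (tnth z.1 j)).

(* pairwise exchangeability of the knockoff mechanism K w.r.t. Q_j :
   for every law D on R^p whose conditional of X_j given X_{-j} is Q_j,
   the law of (X, Xtilde) (X ~ D, Xtilde | X ~ K X) is invariant under the
   swap of X_j and Xtilde_j. *)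
Definition pairwise_exchangeable (R : realType) (p : nat)
    (K : R.-pker (p.-tuple R) ~> (p.-tuple R)) (nu : set R -> \bar R)
    (j : 'I_p) (Q : R -> p.-tuple R -> R) : Prop :=
  forall D : probability (p.-tuple R) R, is_cond_pdf_of D nu j Q ->
  forall C : set (p.-tuple R * p.-tuple R)%type, measurable C ->
    (\int[D]_x K x [set xt | C (x, xt)] =
     \int[D]_x K x [set xt | C (swap_pair j (x, xt))])%E.

(* X_j is independent of Y conditionally on X_{-j}, for (X, Y) ~ PXY :
   the conditional distribution of Y given X can be taken to be a (measurable)
   function of X_{-j} only. *)
Definition cond_indep_Y (R : realType) (p : nat)
    (PXY : probability (p.-tuple R * R)%type R) (j : 'I_p) : Prop :=
  exists kappa : R.-pker (p.-tuple R) ~> R,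
    (forall x t B, kappa (upd x j t) B = kappa x B) /\
    (forall (A : set (p.-tuple R)) (B : set R), measurable A -> measurable B ->
       PXY (A `*` B) = (\int[PXY]_z ((\1_A z.1)%:E * kappa z.1 B))%E).

Definition nulls (R : realType) (p : nat) (PXY : probability (p.-tuple R * R)%type R)
  : {set 'I_p} := [set j | `[< cond_indep_Y PXY j >] ]%SET.

(* a data row (X_i, Xtilde_i, Y_i) *)
Definition krow (R : realType) (p : nat) := ((p.-tuple R * p.-tuple R) * R)%type.

(* rows i.i.d. with X_i,Y_i ~ PXY and Xtilde_i | (X,Y) ~ K(X_i), i.e. the rows
   are independent with common law  C |-> E_PXY[ K X {xt | ((X,xt),Y) in C} ] *)
Definition knockoff_data (R : realType) (p n : nat) d (Omega : measurableType d)
    (P : probability Omega R) (PXY : probability (p.-tuple R * R)%type R)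
    (K : R.-pker (p.-tuple R) ~> (p.-tuple R)) (Z : 'I_n -> Omega -> krow R p)
    : Prop :=
  [/\ (forall i, measurable_fun setT (Z i)),
      (forall i (B : set (krow R p)), measurable B ->
         P (Z i @^-1` B) =
         (\int[PXY]_z K z.1 [set xt | B ((z.1, xt), z.2)])%E) &
      (forall B : 'I_n -> set (krow R p), (forall i, measurable (B i)) ->
         P [set w | forall i, B i (Z i w)] = (\prod_(i < n) P (Z i @^-1` B i))%E)].

Definition swap_row (R : realType) (p : nat) (A : {set 'I_p}) (r : krow R p)
  : krow R p :=
  (([tuple if k \in A then tnth r.1.2 k else tnth r.1.1 k | k < p],
    [tuple if k \in A then tnth r.1.1 k else tnth r.1.2 k | k < p]), r.2).

Definition swap_data (R : realType) (p n : nat) (A : {set 'I_p})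
    (D : n.-tuple (krow R p)) : n.-tuple (krow R p) :=
  [tuple swap_row A (tnth D i) | i < n].

Definition flip_sign (R : realType) (p n : nat)
    (w : n.-tuple (krow R p) -> 'I_p -> R) : Prop :=
  forall (A : {set 'I_p}) D j,
    w (swap_data A D) j = if j \in A then - w D j else w D j.

(* threshold condition at t: plus = true for knockoff+ (offset 1), plus =
   false for knockoff (offset 0).  The ratio (plus + #{W_j <= -t})/#{W_j >= t}
   is <= q, a zero denominator meaning ratio = +oo. *)
Definition thr_ok (R : realType) (p : nat) (plus : bool) (q : R)
    (W : 'I_p -> R) (t : R) : bool :=
  [&& 0 < t, [exists k, `|W k| == t],
      (0 < #|[pred j | (t <= W j)%R]|)%N &
      ((plus%:R + #|[pred j | W j <= - t]|%:R) / #|[pred j | t <= W j]|%:R <= q)].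

(* selected set {j : W_j >= T}, T = min of the admissible t (T = +oo, i.e.
   nothing is selected, if no t is admissible) *)
Definition selected (R : realType) (p : nat) (plus : bool) (q : R)
    (W : 'I_p -> R) : {set 'I_p} :=
  [set j | [exists k, [&& thr_ok plus q W `|W k|,
                          [forall k', thr_ok plus q W `|W k'| ==>
                                       (`|W k| <= `|W k'|)] &
                          `|W k| <= W j]]]%SET.

Definition KLhat (R : realType) (p n : nat) (Pc Qc : 'I_p -> R -> p.-tuple R -> R)
    (j : 'I_p) (D : n.-tuple (krow R p)) : R :=
  \sum_(i < n)
    let x := (tnth D i).1.1 in let xt := (tnth D i).1.2 in
    ln ((Pc j (tnth x j) x * Qc j (tnth xt j) x) /
        (Qc j (tnth x j) x * Pc j (tnth xt j) x)).

Definition data_of (R : realType) (p n : nat) (Omega : Type)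
    (Z : 'I_n -> Omega -> krow R p) (w : Omega) : n.-tuple (krow R p) :=
  [tuple Z i w | i < n].

(* Main.v *)
Require Import Defs.
From HB Require Import structures.
From mathcomp Require Import all_boot all_order all_algebra.
From mathcomp Require Import all_classical all_reals all_analysis.
From mathcomp Require Import finmap measurable_realfun.
Set Implicit Arguments. Unset Strict Implicit. Unset Printing Implicit Defensive.
Import Order.TTheory GRing.Theory Num.Theory.
Import numFieldNormedType.Exports.
Local Open Scope classical_set_scope.
Local Open Scope ring_scope.

(* For a null feature [j], swapping [X_j] with its knockoff in every row changes
   the law of the data by the density [exp (- KL_j)].  Indeed, reweighting the law
   of [X] by [Q_j / P_j] gives a law with conditional [Q_j], for which the knockoffs
   are exchangeable, and [Y] does not see the swap.  Hence
     P(W_j > 0, KL_j <= eps | |W_j|, W_{-j}) <= exp eps * P(W_j < 0 | |W_j|, W_{-j}).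
   A leave-one-out argument then concludes: let [T_j] be the threshold computed with
   [|W_j|] in place of [W_j].  The false selections, divided by [1 + #{W <= - T}],
   have expectation at most [exp eps] times that of
     sum_j 1{W_j <= - T_j} / (1 + #{k != j : W_k <= - T_j}),
   and this sum is at most [1] because all the [T_j] with [W_j <= - T_j] coincide.

   The counting measure on the reals is not sigma-finite, so the conditional
   expectations given [X_{-j}] are not known to be measurable.  They are integrated
   as lower integrals: the disintegration of the law of [X] forces the lower and
   upper integrals to agree, which gives measurability off a null set. *)

(** * Lower integrals *)

Section simple_function_induction.
Import HBNNSimple.

Lemma ge0_mfun_ind d (T : measurableType d) (R : realType)
    (Pr : (T -> \bar R) -> Prop) :
  (forall A, measurable A -> Pr (fun x => (\1_A x)%:E)) ->
  (forall (c : R) (f : T -> \bar R), 0 <= c -> measurable_fun setT f ->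
     (forall x, (0 <= f x)%E) -> Pr f -> Pr (fun x => (c%:E * f x)%E)) ->
  (forall f g : T -> \bar R, measurable_fun setT f -> measurable_fun setT g ->
     (forall x, (0 <= f x)%E) -> (forall x, (0 <= g x)%E) ->
     Pr f -> Pr g -> Pr (fun x => (f x + g x)%E)) ->
  (forall u : nat -> T -> \bar R, (forall n, measurable_fun setT (u n)) ->
     (forall n x, (0 <= u n x)%E) -> (forall x, nondecreasing_seq (u ^~ x)) ->
     (forall n, Pr (u n)) -> Pr (fun x => limn (u ^~ x))) ->
  forall f, measurable_fun setT f -> (forall x, (0 <= f x)%E) -> Pr f.
Proof.
move=> Pi Pc Pa Pl f mf f0.
pose f_ := nnsfun_approx measurableT mf.
have -> : f = (fun x => limn (fun n => (f_ n x)%:E)).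
  by apply/funext => x; apply/esym/cvg_lim => //=; exact: cvg_nnsfun_approx.
apply: Pl => [n|n x|x m n mn|n].
- exact/measurable_EFinP.
- by rewrite lee_fin.
- by rewrite lee_fin; exact/lefP/nd_nnsfun_approx.
have mi (r : R) : measurable (f_ n @^-1` [set r]) by [].
have -> : (fun x => (f_ n x)%:E) = (fun x => \sum_(r <- fset_set (range (f_ n)))
    (r%:E * (\1_(f_ n @^-1` [set r]) x)%:E)%E)%E.
  apply/funext => x; rewrite fimfunE fsbig_finite//= -sumEFin.
  by apply: eq_bigr => r _; rewrite EFinM.
have : forall r, r \in (fset_set (range (f_ n)) : seq R) -> 0 <= r.
  by move=> r; rewrite in_fset_set// => /set_mem[x _ <-].
have P0 : Pr (fun=> 0%E) by have := Pi set0 measurable0; rewrite indic0.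
elim: (fset_set _ : seq R) => [|r s ih] s0.
  by under eq_fun do rewrite big_nil.
under eq_fun do rewrite big_cons.
have s0' r' : r' \in s -> 0 <= r' by move=> r's; apply: s0; rewrite inE r's orbT.
have mI (r' : R) : measurable_fun setT (fun x => (\1_(f_ n @^-1` [set r']) x)%:E : \bar R).
  exact/measurable_EFinP/measurable_indic.
apply: Pa.
- exact: measurable_funeM.
- by apply: emeasurable_sum => r'; exact: measurable_funeM.
- by move=> x; apply: mule_ge0; rewrite lee_fin// s0// inE eqxx.
- move=> x; rewrite big_seq; apply: sume_ge0 => r' r's.
  by apply: mule_ge0; rewrite lee_fin// s0'.
- apply: Pc; [by rewrite s0// inE eqxx|exact: mI| |exact: Pi].
  by move=> x; rewrite lee_fin.
- exact: ih.
Qed.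

End simple_function_induction.

Section lower_integral.
Import HBNNSimple.
Context d (T : measurableType d) (R : realType) (mu : {measure set T -> \bar R}).
Local Open Scope ereal_scope.

Lemma ge0_le_lower_integral (f g : T -> \bar R) : (forall x, 0 <= f x) ->
  (forall x, f x <= g x) -> \int[mu]_x f x <= \int[mu]_x g x.
Proof.
move=> f0 fg.
have g0 x : 0 <= g x by exact: le_trans (f0 x) (fg x).
rewrite !ge0_integralTE//; apply: ereal_sup_le => _ [h hf <-].
by exists h => // x; exact: le_trans (hf x) (fg x).
Qed.

Lemma ge0_lower_integral_null (f : T -> \bar R) (N : set T) :
  (forall x, 0 <= f x) -> measurable N -> mu N = 0 ->
  measurable_fun (~` N) f -> \int[mu]_x f x = \int[mu]_(x in ~` N) f x.
Proof.
move=> f0 mN N0 mf; apply/eqP; rewrite eq_le; apply/andP; split; last first.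
  rewrite integral_mkcond; apply: ge0_le_lower_integral => x.
    by rewrite patchE; case: ifP.
  by rewrite patchE; case: ifP.
pose F x := if x \in N then +oo else f x.
apply: (@le_trans _ _ (\int[mu]_x F x)).
  by apply: ge0_le_lower_integral => // x; rewrite /F; case: ifP => // _; rewrite leey.
have mF : measurable_fun setT F.
  rewrite -(setvU N); apply/measurable_funU => //; first exact: measurableC.
  split.
    by apply: (eq_measurable_fun f) => // x; rewrite in_setC /F => /negbTE ->.
  apply: (eq_measurable_fun (cst +oo)) => [x|]; last exact: measurable_cst.
  by rewrite /F => ->.
rewrite (ge0_negligible_integral mN)//; last first.
  by move=> x _; rewrite /F; case: ifP => // _; rewrite leey.
rewrite setTD le_eqVlt; apply/orP; left; apply/eqP; apply: eq_integral => x.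
by rewrite in_setC /F => /negbTE ->.
Qed.

Lemma lower_integral_attained (f : T -> \bar R) : (forall x, 0 <= f x) ->
  \int[mu]_x f x < +oo ->
  exists g : T -> \bar R, [/\ measurable_fun setT g, (forall x, 0 <= g x),
    (forall x, g x <= f x) & \int[mu]_x g x = \int[mu]_x f x].
Proof.
move=> f0 foo.
have ff : \int[mu]_x f x \is a fin_num by rewrite ge0_fin_numE// integral_ge0.
have step n : exists h : {nnsfun T >-> R}, (forall x, (h x)%:E <= f x) /\
    \int[mu]_x f x - n.+1%:R^-1%:E <= \int[mu]_x (h x)%:E.
  have e0 : (0 < n.+1%:R^-1 :> R)%R by rewrite invr_gt0.
  have := ff; rewrite ge0_integralTE// => /(ub_ereal_sup_adherent e0).
  move=> [_ [h hf <-]] hlt; exists h; split => //.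
  by rewrite integralT_nnsfun ltW.
have [h hP] := choice step.
pose g x := esups (fun n => (h n x)%:E) 0%N.
have hg n x : (h n x)%:E <= g x by apply: ereal_sup_ubound; exists n.
have g0 x : 0 <= g x by apply: le_trans (hg 0%N x); rewrite lee_fin.
have gf x : g x <= f x by apply: ge_ereal_sup => _ [n /= _ <-]; exact: (hP n).1.
have mg : measurable_fun setT g.
  by apply: measurable_fun_esups => // n; exact/measurable_EFinP.
exists g; split => //; apply/eqP; rewrite eq_le ge0_le_lower_integral//=.
apply/lee_addgt0Pr => e e0.
have [n ne] : exists n : nat, (n.+1%:R^-1 < e)%R.
  exists (Num.truncn e^-1); rewrite invf_plt ?posrE//; exact: truncnS_gt.
rewrite -leeBlDr//; apply: (@le_trans _ _ (\int[mu]_x f x - n.+1%:R^-1%:E)).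
  by rewrite leeB// lee_fin ltW.
apply: (le_trans (hP n).2); apply: ge0_le_lower_integral => x; first by rewrite lee_fin.
exact: hg.
Qed.

Lemma lower_integral_compl (f : T -> \bar R) : mu setT = 1 ->
  (forall x, 0 <= f x <= 1) ->
  \int[mu]_x f x + \int[mu]_x (1 - f x) = 1 ->
  exists N, [/\ measurable N, mu N = 0, measurable_fun (~` N) f &
    \int[mu]_(x in ~` N) f x = \int[mu]_x f x].
Proof.
move=> mu1 f01 f1.
have f0 x : 0 <= f x by have /andP[] := f01 x.
have ffin x : f x \is a fin_num.
  by have /andP[a b] := f01 x; rewrite ge0_fin_numE// (le_lt_trans b)// ltey.
have f'0 x : 0 <= 1 - f x by rewrite sube_ge0 ?ffin//; have /andP[] := f01 x.
have le1 (h : T -> \bar R) : (forall x, 0 <= h x) -> (forall x, h x <= 1) ->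
    \int[mu]_x h x < +oo.
  move=> h0 h1; apply: (@le_lt_trans _ _ (\int[mu]_x cst 1 x)).
    exact: ge0_le_lower_integral.
  by rewrite integral_cst// mu1 mule1 ltey.
have [g [mg g0 gf ig]] : exists g : T -> \bar R, [/\ measurable_fun setT g,
    (forall x, 0 <= g x), (forall x, g x <= f x) & \int[mu]_x g x = \int[mu]_x f x].
  by apply: lower_integral_attained => //; apply: le1 => // x; have /andP[] := f01 x.
have [k [mk k0 kf ik]] : exists g : T -> \bar R, [/\ measurable_fun setT g,
    (forall x, 0 <= g x), (forall x, g x <= 1 - f x) &
    \int[mu]_x g x = \int[mu]_x (1 - f x)].
  apply: lower_integral_attained => //; apply: le1 => // x.
  by rewrite leeBlDr ?leeDl.
have gkle x : g x + k x <= 1.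
  by apply: (le_trans (leeD (gf x) (kf x))); rewrite addeC subeK.
have gkfin x : g x + k x \is a fin_num.
  by rewrite ge0_fin_numE ?adde_ge0// (le_lt_trans (gkle x))// ltey.
have mgk : measurable_fun setT (fun x => g x + k x) by exact: emeasurable_funD.
have mr : measurable_fun setT (fun x => 1 - (g x + k x)).
  by apply: emeasurable_funB.
have r0 x : 0 <= 1 - (g x + k x) by rewrite sube_ge0 ?gkfin.
have : \int[mu]_x (1 - (g x + k x)) = 0.
  have igk : \int[mu]_x (g x + k x) = 1 by rewrite ge0_integralD// ig ik.
  have : \int[mu]_x ((1 - (g x + k x)) + (g x + k x)) = 1.
    under eq_integral do rewrite subeK//.
    by rewrite integral_cst// mu1 mule1.
  rewrite ge0_integralD//; last by move=> x _; rewrite adde_ge0.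
  rewrite igk => /(congr1 (fun z => z - 1)); rewrite addeK// subee//.
move=> r_int.
pose N := [set x | 1 - (g x + k x) != 0].
have mN : measurable N by rewrite -[N]setTI; exact: emeasurable_neq.
have N0 : mu N = 0.
  have /(ae_eq_integral_abs _ measurableT mr)[M [mM M0 NM]] :
      \int[mu]_x `|1 - (g x + k x)| = 0.
    by rewrite -[RHS]r_int; apply: eq_integral => x _; rewrite gee0_abs.
  apply: (subset_measure0 mN mM) => // x /= /eqP xN; apply: NM => /=.
  by move=> /(_ Logic.I).
have fg x : ~ N x -> f x = g x.
  move=> /negP; rewrite negbK => /eqP gk1.
  apply/eqP; rewrite eq_le gf andbT.
  have {}gk1 : g x + k x = 1.
    have := gk1; move/(congr1 (fun z => z + (g x + k x))).
    by rewrite subeK// add0e => <-.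
  have kfin : k x \is a fin_num.
    by have := gkfin x; rewrite fin_numD => /andP[].
  have gE : g x = 1 - k x by rewrite -gk1 addeK.
  by rewrite gE leeBrDr// addeC -leeBrDr// kf.
have mf : measurable_fun (~` N) f.
  apply: (eq_measurable_fun g) => [x|]; last exact: measurable_funTS.
  by move=> /set_mem/fg ->.
exists N; split => //.
by rewrite [RHS](ge0_lower_integral_null f0 mN N0).
Qed.

End lower_integral.

(** * Densities and semidirect products *)

Lemma measurable_EFin_indic d (T : measurableType d) (R : realType) (A : set T) :
  measurable A -> measurable_fun setT (fun x => (\1_A x)%:E : \bar R).
Proof. by move=> mA; exact/measurable_EFinP/measurable_indic. Qed.

Lemma eq_law_integral d1 d2 d (T1 : measurableType d1) (T2 : measurableType d2)
    (T : measurableType d) (R : realType) (m1 : {measure set T1 -> \bar R})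
    (m2 : {measure set T2 -> \bar R}) (f1 : T1 -> T) (f2 : T2 -> T) :
  measurable_fun setT f1 -> measurable_fun setT f2 ->
  (forall A, measurable A -> m1 (f1 @^-1` A) = m2 (f2 @^-1` A)) ->
  forall g : T -> \bar R, measurable_fun setT g -> (forall x, (0 <= g x)%E) ->
  (\int[m1]_x g (f1 x) = \int[m2]_x g (f2 x))%E.
Proof.
move=> mf1 mf2 m12.
have mc1 (g : T -> \bar R) : measurable_fun setT g -> measurable_fun setT (fun x => g (f1 x)).
  by move=> mg; exact: measurableT_comp.
have mc2 (g : T -> \bar R) : measurable_fun setT g -> measurable_fun setT (fun x => g (f2 x)).
  by move=> mg; exact: measurableT_comp.
apply: ge0_mfun_ind.
- move=> A mA.
  have m1A : measurable (f1 @^-1` A) by rewrite -[X in measurable X]setTI; exact: mf1.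
  have m2A : measurable (f2 @^-1` A) by rewrite -[X in measurable X]setTI; exact: mf2.
  rewrite (_ : (fun x => _) = (fun x => (\1_(f1 @^-1` A) x)%:E)) //.
  rewrite (_ : (fun x => (\1_A (f2 x))%:E) = (fun x => (\1_(f2 @^-1` A) x)%:E)) //.
  by rewrite !integral_indic// !setIT m12.
- by move=> c f c0 mf f0 ih; rewrite !ge0_integralZl ?lee_fin ?ih//; [exact: mc2|exact: mc1].
- move=> f g mf mg f0 g0 ihf ihg.
  by rewrite !ge0_integralD ?ihf ?ihg//; [exact: mc2|exact: mc2|exact: mc1|exact: mc1].
- move=> u mu u0 und ih.
  rewrite monotone_convergence//; last by move=> n; exact: mc1.
  rewrite monotone_convergence//; last by move=> n; exact: mc2.
  by congr (limn _); apply/funext => n; exact: ih.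
Qed.

Section density_measure.
Context d (T : measurableType d) (R : realType) (mu : {measure set T -> \bar R}).
Variable a : T -> \bar R.
Hypotheses (ma : measurable_fun setT a) (a0 : forall x, (0 <= a x)%E).
Local Open Scope ereal_scope.

Definition density_measure of measurable_fun setT a & (forall x, 0 <= a x) :=
  fun A => \int[mu]_(x in A) a x.

Local Notation dm := (density_measure ma a0).

Let dm0 : dm set0 = 0. Proof. by rewrite /density_measure integral_set0. Qed.

Let dm_ge0 A : 0 <= dm A. Proof. by apply: integral_ge0 => x _. Qed.

Let dm_sigma_additive : semi_sigma_additive dm.
Proof.
move=> /= F mF tF mUF; rewrite /density_measure; apply: cvg_toP.
  apply: ereal_nondecreasing_is_cvgn => m n mn.
  by apply: lee_sum_nneg_natr => // k _ _; exact: integral_ge0.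
rewrite ge0_integral_bigcup//=; exact: measurable_funTS.
Qed.

HB.instance Definition _ := isMeasure.Build _ _ _ dm dm0 dm_ge0 dm_sigma_additive.

Lemma ge0_integral_density (f : T -> \bar R) :
  measurable_fun setT f -> (forall x, 0 <= f x) ->
  \int[dm]_x f x = \int[mu]_x (f x * a x).
Proof.
move: f; apply: ge0_mfun_ind.
- move=> A mA; rewrite integral_indic// setIT; rewrite [LHS]integral_mkcond.
  by apply: eq_integral => x _; rewrite epatch_indic muleC.
- move=> c f c0 mf f0 ih; under [RHS]eq_integral do rewrite -muleA.
  rewrite !ge0_integralZl ?lee_fin ?ih//; first exact: emeasurable_funM.
  by move=> x _; exact: mule_ge0.
- move=> f g mf mg f0 g0 ihf ihg.
  under [RHS]eq_integral do rewrite ge0_muleDl//.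
  rewrite !ge0_integralD ?ihf ?ihg//.
  + by move=> x _; exact: mule_ge0.
  + exact: emeasurable_funM.
  + by move=> x _; exact: mule_ge0.
  + exact: emeasurable_funM.
- move=> u mu' u0 und ih.
  transitivity (\int[mu]_x limn (fun n => u n x * a x)).
    rewrite monotone_convergence//.
    rewrite monotone_convergence//; last 3 first.
    + by move=> n; exact: emeasurable_funM.
    + by move=> n x _; exact: mule_ge0.
    + by move=> x _ m n mn; apply: lee_wpmul2r => //; exact: und.
    by congr (limn _); apply/funext => n; exact: ih.
  apply: eq_integral => x _; apply/cvg_lim => //.
  have uc : u n x @[n --> \oo] --> limn (u ^~ x).
    exact/(ereal_nondecreasing_is_cvgn (und x)).
  have l0 : 0 <= limn (u ^~ x).
    apply: lime_ge; first exact/(ereal_nondecreasing_is_cvgn (und x)).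
    by apply: nearW => n.
  case ax : (a x) (a0 x) => [r| |] // r0.
    by apply: cvgeZr.
  have [e0|e0] := eqVneq (limn (u ^~ x)) 0.
    rewrite e0 mul0e; apply: cvg_near_cst; apply: nearW => n.
    suff -> : u n x = 0 by rewrite mul0e.
    apply/eqP; rewrite eq_le u0 andbT -[leRHS]e0.
    rewrite (cvg_lim _ (ereal_nondecreasing_cvgn (und x)))//.
    by apply: ereal_sup_ubound; exists n.
  rewrite gt0_muley; last by rewrite lt0e e0.
  apply: cvg_near_cst.
  have : 0 < limn (u ^~ x) by rewrite lt0e e0.
  rewrite (cvg_lim _ (ereal_nondecreasing_cvgn (und x)))//.
  move=> /ereal_sup_gt[_ [n _ <-] un0].
  exists n => // m /= nm; rewrite gt0_muley//.
  by rewrite (lt_le_trans un0)//; exact: und.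
Qed.

Definition density_probability of \int[mu]_x a x = 1 := dm.

Hypothesis a1 : \int[mu]_x a x = 1.

HB.instance Definition _ := Measure.on (density_probability a1).

Let density_probability_setT : density_probability a1 setT = 1. Proof. exact: a1. Qed.

HB.instance Definition _ := Measure_isProbability.Build _ _ _
  (density_probability a1) density_probability_setT.

End density_measure.

Section semidirect.
Context dx dy (X : measurableType dx) (Y : measurableType dy) (R : realType).
Variables (D : {measure set X -> \bar R}) (k : R.-fker X ~> Y).
Local Open Scope ereal_scope.

Definition semidirect (C : set (X * Y)) := \int[D]_x k x (xsection C x).

Let mk C : measurable C -> measurable_fun setT (fun x => k x (xsection C x)).
Proof. by move=> mC; apply: measurable_fun_xsection_finite_kernel; exact/mem_set. Qed.

Let sd0 : semidirect set0 = 0.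
Proof. by rewrite /semidirect integral0_eq// => x _; rewrite xsection0 measure0. Qed.

Let sd_ge0 C : 0 <= semidirect C. Proof. exact: integral_ge0. Qed.

Let sd_sigma_additive : semi_sigma_additive semidirect.
Proof.
move=> F mF tF mUF.
have -> : semidirect (\bigcup_n F n) = \sum_(n <oo) semidirect (F n).
  rewrite /semidirect -integral_nneseries//; last by move=> n; exact: mk.
  apply: eq_integral => x _; rewrite xsection_bigcup.
  apply/esym/cvg_lim => //; apply: measure_sigma_additive.
    by move=> n; exact: measurable_xsection.
  exact: trivIset_xsection.
exact: is_cvg_nneseries.
Qed.

HB.instance Definition _ := isMeasure.Build _ _ _ semidirect sd0 sd_ge0 sd_sigma_additive.

Lemma measurable_fun_integral_fker (f : X * Y -> \bar R) :
  measurable_fun setT f -> (forall z, 0 <= f z) ->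
  measurable_fun setT (fun x => \int[k x]_y f (x, y)).
Proof. by move=> mf f0; exact: measurable_fun_integral_finite_kernel. Qed.

Lemma ge0_integral_semidirect (f : X * Y -> \bar R) :
  measurable_fun setT f -> (forall z, 0 <= f z) ->
  \int[semidirect]_z f z = \int[D]_x \int[k x]_y f (x, y).
Proof.
have ms (g : X * Y -> \bar R) x : measurable_fun setT g ->
    measurable_fun setT (fun y => g (x, y)).
  by move=> mg; apply: measurableT_comp => //; exact: measurable_pair1.
move: f; apply: ge0_mfun_ind.
- move=> A mA; rewrite integral_indic// setIT; apply: eq_integral => x _.
  rewrite (_ : (fun y => _) = (fun y => (\1_(xsection A x) y)%:E)).
    by rewrite integral_indic ?setIT//; exact: measurable_xsection.
  by apply/funext => y; rewrite !indicE mem_xsection.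
- move=> c f c0 mf f0 ih.
  under [RHS]eq_integral => x _.
    rewrite ge0_integralZl ?lee_fin//; last exact: ms.
    over.
  rewrite !ge0_integralZl ?lee_fin ?ih//; first exact: measurable_fun_integral_fker.
  by move=> x _; exact: integral_ge0.
- move=> f g mf mg f0 g0 ihf ihg.
  under [RHS]eq_integral => x _.
    rewrite ge0_integralD//; [|exact: ms|exact: ms].
    over.
  rewrite ge0_integralD// ihf ihg [RHS]ge0_integralD//.
  + by move=> x _; exact: integral_ge0.
  + exact: measurable_fun_integral_fker.
  + by move=> x _; exact: integral_ge0.
  + exact: measurable_fun_integral_fker.
- move=> u mu u0 und ih; rewrite monotone_convergence//.
  under [RHS]eq_integral => x _.
    rewrite monotone_convergence//; last by move=> n; exact: ms.
    over.
  rewrite monotone_convergence//.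
  + by congr (limn _); apply/funext => n; exact: ih.
  + by move=> n; exact: measurable_fun_integral_fker.
  + by move=> n x _; exact: integral_ge0.
  + move=> x _ m n mn; apply: ge0_le_integral => //.
    * exact: ms.
    * exact: ms.
    * by move=> y _; exact: und.
Qed.

End semidirect.

Lemma prod_measure_unique d1 d2 (T1 : measurableType d1) (T2 : measurableType d2)
    (R : realType) (m1 m2 : {measure set (T1 * T2) -> \bar R}) :
  (m1 setT < +oo)%E ->
  (forall A B, measurable A -> measurable B -> m1 (A `*` B) = m2 (A `*` B)) ->
  forall C, measurable C -> m1 C = m2 C.
Proof.
move=> m1oo m12 C mC.
pose G := [set A `*` B | A in @measurable _ T1 & B in @measurable _ T2].
apply: (measure_unique G (fun=> setT)) => //.
- exact: measurable_prod_measurableType.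
- move=> _ _ [A1 mA1 [A2 mA2 <-]] [B1 mB1 [B2 mB2 <-]].
  exists (A1 `&` B1); first exact: measurableI.
  exists (A2 `&` B2); first exact: measurableI.
  by rewrite setXI.
- by move=> n; exists setT => //; exists setT => //; rewrite setXTT.
- by rewrite bigcup_const//; exists 0%N.
- by move=> _ [A mA [B mB <-]]; exact: m12.
Qed.

(** * Conditional expectation given the other coordinates *)

Lemma tnth_upd (T : Type) (p : nat) (x : p.-tuple T) j t i :
  tnth (upd x j t) i = if i == j then t else tnth x i.
Proof. by rewrite tnth_mktuple. Qed.

Lemma upd_upd (T : Type) (p : nat) (x : p.-tuple T) j t t' :
  upd (upd x j t) j t' = upd x j t'.
Proof. by apply: eq_from_tnth => i; rewrite !tnth_upd; case: eqP. Qed.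

Lemma measurable_upd d d' (U : measurableType d) (T : measurableType d') (p : nat)
    (j : 'I_p) (g : U -> p.-tuple T) (h : U -> T) :
  measurable_fun setT g -> measurable_fun setT h ->
  measurable_fun setT (fun u => upd (g u) j (h u)).
Proof.
move=> mg mh; apply/measurable_fun_tnthP => i.
have [->|ij] := eqVneq i j.
  by rewrite (_ : _ \o _ = h)//; apply/funext => u /=; rewrite tnth_upd eqxx.
rewrite (_ : _ \o _ = (fun x => tnth x i) \o g); last first.
  by apply/funext => u /=; rewrite tnth_upd (negbTE ij).
by apply: measurableT_comp => //; exact: measurable_tnth.
Qed.

Section conditional_expectation.
Context (R : realType) (p : nat) (nu : {measure set R -> \bar R}) (j : 'I_p).
Variable f : R -> p.-tuple R -> R.
Hypothesis hf : cond_pdf nu j f.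
Local Open Scope ereal_scope.
Implicit Types (h : p.-tuple R -> \bar R) (x : p.-tuple R).

(* Measurability in [x] is not available when [nu] is the counting measure. *)
Definition cexp h x := \int[nu]_t (h (upd x j t) * (f t x)%:E).

Let mf1 x : measurable_fun setT (fun t => (f t x)%:E).
Proof.
have [mf _ _ _] := hf; apply/measurable_EFinP.
exact: (measurableT_comp mf (measurable_pair2 x)).
Qed.

Let f0 t x : (0 <= f t x)%R. Proof. by have [] := hf. Qed.

Let mh1 h x : measurable_fun setT h ->
  measurable_fun setT (fun t => h (upd x j t) * (f t x)%:E).
Proof.
move=> mh; apply: emeasurable_funM => //.
apply: measurableT_comp => //.
by apply: measurable_upd => //; exact: measurable_cst.
Qed.

Let h01 h x t : (forall y, 0 <= h y) -> 0 <= h (upd x j t) * (f t x)%:E.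
Proof. by move=> h0; apply: mule_ge0 => //; rewrite lee_fin. Qed.

Lemma cexp_ge0 h x : (forall y, 0 <= h y) -> 0 <= cexp h x.
Proof. by move=> h0; apply: integral_ge0 => t _; exact: h01. Qed.

Lemma cexp_upd h x t : cexp h (upd x j t) = cexp h x.
Proof.
by apply: eq_integral => t' _; rewrite upd_upd; have [_ _ -> _] := hf.
Qed.

Lemma cexpZ c h x : (0 <= c)%R -> measurable_fun setT h -> (forall y, 0 <= h y) ->
  cexp (fun y => c%:E * h y) x = c%:E * cexp h x.
Proof.
move=> c0 mh h0; rewrite /cexp -ge0_integralZl ?lee_fin//.
- by apply: eq_integral => t _; rewrite muleA.
- exact: mh1.
- by move=> t _; exact: h01.
Qed.

Lemma cexpD h g x : measurable_fun setT h -> measurable_fun setT g ->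
  (forall y, 0 <= h y) -> (forall y, 0 <= g y) ->
  cexp (fun y => h y + g y) x = cexp h x + cexp g x.
Proof.
move=> mh mg h0 g0; rewrite /cexp -ge0_integralD//.
- by apply: eq_integral => t _; rewrite ge0_muleDl.
- by move=> t _; exact: h01.
- exact: mh1.
- by move=> t _; exact: h01.
- exact: mh1.
Qed.

Lemma cexp1 x : cexp (cst 1) x = 1.
Proof.
have [_ _ _ /(_ x) f1] := hf; rewrite -[RHS]f1.
by apply: eq_integral => t _; rewrite mul1e.
Qed.

Lemma cexp_lim (u : nat -> p.-tuple R -> \bar R) x :
  (forall n, measurable_fun setT (u n)) -> (forall n y, 0 <= u n y) ->
  (forall y, nondecreasing_seq (u ^~ y)) ->
  cexp (fun y => limn (u ^~ y)) x = limn (fun n => cexp (u n) x).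
Proof.
move=> mu u0 und; rewrite /cexp -monotone_convergence//; last 3 first.
- by move=> n; exact: mh1.
- by move=> n t _; exact: h01.
- by move=> t _ m n mn; apply: lee_wpmul2r; [rewrite lee_fin|exact: und].
apply: eq_integral => t _; apply/esym/cvg_lim => //; apply: cvgeZr => //.
exact/(ereal_nondecreasing_is_cvgn (und _)).
Qed.

Lemma cexp_nondecreasing (u : nat -> p.-tuple R -> \bar R) x :
  (forall n, measurable_fun setT (u n)) -> (forall n y, 0 <= u n y) ->
  (forall y, nondecreasing_seq (u ^~ y)) ->
  nondecreasing_seq (fun n => cexp (u n) x).
Proof.
move=> mu u0 und m n mn; apply: ge0_le_integral => //.
- by move=> t _; exact: h01.
- exact: mh1.
- exact: mh1.
- by move=> t _; apply: lee_wpmul2r; [rewrite lee_fin|exact: und].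
Qed.

Variable D : probability (p.-tuple R) R.
Hypothesis hD : is_cond_pdf_of D nu j f.

Lemma integral_setCU (h : p.-tuple R -> \bar R) (N M : set (p.-tuple R)) :
  measurable N -> measurable M -> D M = 0 -> (forall x, 0 <= h x) ->
  measurable_fun (~` N) h ->
  \int[D]_(x in ~` (N `|` M)) h x = \int[D]_(x in ~` N) h x.
Proof.
move=> mN mM M0 h0 mh; rewrite [RHS](ge0_negligible_integral mM)//.
  by rewrite setCU setDE.
exact: measurableC.
Qed.

Lemma tower h : measurable_fun setT h -> (forall x, 0 <= h x) ->
  exists N, [/\ measurable N, D N = 0, measurable_fun (~` N) (cexp h) &
    \int[D]_(x in ~` N) cexp h x = \int[D]_x h x].
Proof.
move: h; apply: ge0_mfun_ind.
- move=> A mA.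
  have i0 (B : set (p.-tuple R)) y : 0 <= (\1_B y)%:E :> \bar R by rewrite lee_fin.
  have AC x : cexp (fun y => (\1_A y)%:E) x + cexp (fun y => (\1_(~` A) y)%:E) x = 1.
    rewrite -cexpD//; last 2 first.
      exact: measurable_EFin_indic.
      by apply: measurable_EFin_indic; exact: measurableC.
    rewrite -[RHS](cexp1 x); apply: eq_integral => t _; congr (_ * _).
    by rewrite -EFinD !indicE in_setC; case: (_ \in A); rewrite /= ?addr0 ?add0r.
  have le1 x : 0 <= cexp (fun y => (\1_A y)%:E) x <= 1.
    by rewrite cexp_ge0//= -(AC x) leeDl// cexp_ge0.
  have CE x : cexp (fun y => (\1_(~` A) y)%:E) x = 1 - cexp (fun y => (\1_A y)%:E) x.
    rewrite -(AC x) addeC addeK//.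
    by have /andP[a b] := le1 x; rewrite ge0_fin_numE// (le_lt_trans b)// ltey.
  have [|N [mN N0 mN' iN]] := lower_integral_compl (probability_setT D) le1.
    under [X in _ + X]eq_integral do rewrite -CE.
    rewrite -[X in X + _]hD// -[X in _ + X]hD; last exact: measurableC.
    by rewrite probability_setC// addeC subeK ?fin_num_measure.
  exists N; split => //; rewrite iN integral_indic// setIT.
  by rewrite [RHS]hD.
- move=> c h c0 mh h0 [N [mN N0 mN' iN]]; exists N; split => //.
    apply: (eq_measurable_fun (fun x => c%:E * cexp h x)).
      by move=> x _; rewrite cexpZ.
    exact: measurable_funeM.
  under eq_integral do rewrite cexpZ//.
  rewrite !ge0_integralZl ?lee_fin ?iN//; first exact: measurableC.
  by move=> x _; exact: cexp_ge0.
- move=> h g mh mg h0 g0 [N [mN N0 mN' iN]] [M [mM M0 mM' iM]].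
  have mNM : measurable (~` (N `|` M)) by apply/measurableC/measurableU.
  have mNMh : measurable_fun (~` (N `|` M)) (cexp h).
    apply: (measurable_funS (measurableC mN)) mN'.
    by rewrite setCU => x [].
  have mNMg : measurable_fun (~` (N `|` M)) (cexp g).
    apply: (measurable_funS (measurableC mM)) mM'.
    by rewrite setCU => x [].
  exists (N `|` M); split.
  + exact: measurableU.
  + apply/negligibleP; first exact: measurableU.
    by apply: negligibleU; apply/negligibleP.
  + apply: (eq_measurable_fun (fun x => cexp h x + cexp g x)).
      by move=> x _; rewrite cexpD.
    exact: emeasurable_funD.
  under eq_integral do rewrite cexpD//.
  rewrite [RHS]ge0_integralD// [LHS]ge0_integralD//; last 2 first.
    by move=> x _; exact: cexp_ge0.
    by move=> x _; exact: cexp_ge0.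
  rewrite integral_setCU//; last by move=> x; exact: cexp_ge0.
  rewrite iN; congr (_ + _).
  rewrite setUC integral_setCU//; by move=> x; exact: cexp_ge0.
- move=> u mu u0 und /choice[N hN].
  have mN n : measurable (N n) by have [] := hN n.
  have mUN : measurable (\bigcup_n N n) by exact: bigcupT_measurable.
  have CN n : ~` (\bigcup_n N n) `<=` ~` N n by move=> x /= nx Nx; apply: nx; exists n.
  have mc n : measurable_fun (~` (\bigcup_n N n)) (cexp (u n)).
    have [_ _ m _] := hN n.
    exact: (measurable_funS (measurableC (mN n)) (CN n)).
  have UN0 : D (\bigcup_n N n) = 0.
    apply/negligibleP => //; apply: negligible_bigcup => n.
    by apply/negligibleP => //; have [] := hN n.
  exists (\bigcup_n N n); split => //.
    apply: (emeasurable_fun_cvg (fun n => cexp (u n))) => // x _.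
    rewrite cexp_lim//; apply: ereal_nondecreasing_is_cvgn.
    exact: cexp_nondecreasing.
  under eq_integral do rewrite cexp_lim//.
  rewrite !monotone_convergence//; last 3 first.
  + exact: measurableC.
  + by move=> n x _; exact: cexp_ge0.
  + by move=> x _; exact: cexp_nondecreasing.
  congr (limn _); apply/funext => n; have [_ _ m <-] := hN n.
  rewrite -(integral_setCU (mN n) mUN UN0)//; last by move=> x; exact: cexp_ge0.
  congr (integral _ (~` _) _); apply/seteqP; split => x; [by right|].
  by case=> // Nx; exists n.
Qed.

End conditional_expectation.

Lemma ge0_measurable_funV d (T : measurableType d) (R : realType) (h : T -> R) :
  measurable_fun setT h -> (forall x, 0 <= h x) ->
  measurable_fun setT (fun x => (h x)^-1).
Proof.
move=> mh h0; rewrite (_ : (fun x => _) = (fun x => h x `^ (-1))); last first.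
  by apply/funext => x; rewrite powR_inv1.
exact: (measurableT_comp (measurable_powR _)).
Qed.

Section tilt.
Context (R : realType) (p : nat) (nu : {measure set R -> \bar R}) (j : 'I_p).
Variables f g : R -> p.-tuple R -> R.
Hypotheses (hf : cond_pdf nu j f) (hg : cond_pdf nu j g).
Hypothesis supp : forall t x, 0 < f t x <-> 0 < g t x.
Implicit Types (x : p.-tuple R).

Definition lratio x : R := g (tnth x j) x / f (tnth x j) x.

Lemma measurable_cond_pdf_diag d (U : measurableType d) (k : R -> p.-tuple R -> R)
    (t : U -> R) (x : U -> p.-tuple R) :
  cond_pdf nu j k -> measurable_fun setT t -> measurable_fun setT x ->
  measurable_fun setT (fun u => k (t u) (x u)).
Proof.
move=> [mk _ _ _] mt mx.
rewrite (_ : (fun u => _) = (fun tx => k tx.1 tx.2) \o (fun u => (t u, x u)))//.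
by apply: measurableT_comp => //; exact: measurable_fun_pair.
Qed.

Lemma measurable_lratio : measurable_fun setT lratio.
Proof.
have [_ f0 _ _] := hf.
apply: measurable_funM.
  by apply: measurable_cond_pdf_diag => //; exact: measurable_tnth.
apply: ge0_measurable_funV => //.
by apply: measurable_cond_pdf_diag => //; exact: measurable_tnth.
Qed.

Lemma lratio_ge0 x : 0 <= lratio x.
Proof. by have [_ f0 _ _] := hf; have [_ g0 _ _] := hg; rewrite divr_ge0. Qed.

Lemma cond_pdf_upd (k : R -> p.-tuple R -> R) x t t' : cond_pdf nu j k ->
  k t (upd x j t') = k t x.
Proof. by case. Qed.

Lemma lratio_upd x t : lratio (upd x j t) * f t x = g t x.
Proof.
rewrite /lratio tnth_upd eqxx !cond_pdf_upd//.
have [_ f0 _ _] := hf; have [_ g0 _ _] := hg.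
have [fz|fz] := eqVneq (f t x) 0; last by rewrite divfK.
rewrite fz mulr0; apply/esym/eqP; rewrite eq_le g0 andbT leNgt.
by apply/negP => /supp; rewrite fz ltxx.
Qed.

Local Open Scope ereal_scope.

Lemma cexp_lratio (h : p.-tuple R -> \bar R) x :
  cexp nu j f (fun y => h y * (lratio y)%:E) x = cexp nu j g h x.
Proof.
by apply: eq_integral => t _; rewrite -muleA -EFinM lratio_upd.
Qed.

Variable D : probability (p.-tuple R) R.
Hypothesis hD : is_cond_pdf_of D nu j f.

Let ma : measurable_fun setT (EFin \o lratio).
Proof. by apply/measurable_EFinP; exact: measurable_lratio. Qed.

Let a0 x : 0 <= (EFin \o lratio) x. Proof. by rewrite lee_fin lratio_ge0. Qed.

Let a1 : \int[D]_x (EFin \o lratio) x = 1.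
Proof.
have [N [mN N0 mc <-]] := tower hf hD ma a0.
rewrite (eq_integral (cst 1)) => [|x _]; last first.
  rewrite -[RHS](cexp1 hg x) -cexp_lratio.
  by apply: eq_integral => t _; rewrite mul1e.
rewrite integral_cst; last exact: measurableC.
by rewrite mul1e [LHS](probability_setC D mN) N0 sube0.
Qed.

Definition tilt : probability (p.-tuple R) R := density_probability ma a0 a1.

Lemma integral_tilt (h : p.-tuple R -> \bar R) : measurable_fun setT h ->
  (forall x, 0 <= h x) -> \int[tilt]_x h x = \int[D]_x (h x * (lratio x)%:E).
Proof. by move=> mh h0; exact: ge0_integral_density. Qed.

Lemma tilt_cond_pdf : is_cond_pdf_of tilt nu j g.
Proof.
move=> A mA.
pose iA := fun x : p.-tuple R => (\1_A x)%:E : \bar R.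
have miA : measurable_fun setT iA by exact: measurable_EFin_indic.
have iA0 x : 0 <= iA x by rewrite lee_fin.
pose hA := cexp nu j g iA.
have hA0 x : 0 <= hA x by exact: (cexp_ge0 hg).
rewrite [RHS](_ : _ = \int[tilt]_x hA x)//.
have mAa : measurable_fun setT (fun y => iA y * (lratio y)%:E) by exact: (emeasurable_funM miA ma).
have Aa0 y : 0 <= iA y * (lratio y)%:E by rewrite mule_ge0// ?a0.
have [N [mN N0 mh ih]] := tower hf hD mAa Aa0.
rewrite (_ : cexp _ _ _ _ = hA) in mh ih; last by apply/funext => x; exact: cexp_lratio.
have tN0 : tilt N = 0.
  rewrite -[N in LHS]setIT -integral_indic// integral_tilt//; last exact: measurable_EFin_indic.
  rewrite (ge0_negligible_integral mN)//; last 2 first.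
    by apply: emeasurable_funM; [exact: measurable_EFin_indic|exact: ma].
    by move=> x _; rewrite mule_ge0 ?lee_fin ?lratio_ge0.
  apply: integral0_eq => x [_ Nx].
  by rewrite indicE memNset// mul0e.
rewrite (ge0_lower_integral_null hA0 mN tN0 mh) integral_mkcond.
set k := hA \_ (~` N).
have k0 x : 0 <= k x by rewrite /k patchE; case: ifP.
have mk : measurable_fun setT k by apply/(measurable_restrictT _ _).1 => //; exact: measurableC.
rewrite integral_tilt//.
have mka : measurable_fun setT (fun y => k y * (lratio y)%:E) by exact: (emeasurable_funM mk ma).
have ka0 y : 0 <= k y * (lratio y)%:E by rewrite mule_ge0// ?a0.
have [M [mM M0 mkM <-]] := tower hf hD mka ka0.
have miN : measurable_fun setT (fun x => (\1_N x)%:E : \bar R) by exact: measurable_EFin_indic.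
have iN0 x : 0 <= (\1_N x)%:E :> \bar R by rewrite lee_fin.
have [L [mL L0 mcL iL]] := tower hf hD miN iN0.
have {}iL : \int[D]_(x in ~` L) cexp nu j f (fun x => (\1_N x)%:E) x = 0.
  by rewrite iL integral_indic// setIT; exact: N0.
have [E [mE E0 LE]] : ae_eq D (~` L) (cexp nu j f (fun x => (\1_N x)%:E)) (cst 0).
  apply/ae_eq_integral_abs => //; first exact: measurableC.
  rewrite -[RHS]iL; apply: eq_integral => x _; rewrite gee0_abs//.
  exact: (cexp_ge0 hf).
have mML : measurable (M `|` (L `|` E)) by do 2 apply: measurableU => //.
have ML0 : D (M `|` (L `|` E)) = 0.
  by apply/negligibleP => //; do 2 (apply: negligibleU; [exact/negligibleP|]); exact/negligibleP.
have mNLO : measurable (N `|` (L `|` E)) by do 2 apply: measurableU => //.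
have NLO0 : D (N `|` (L `|` E)) = 0.
  by apply/negligibleP => //; do 2 (apply: negligibleU; [exact/negligibleP|]); exact/negligibleP.
transitivity (\int[D]_(x in ~` N) hA x).
  by rewrite ih -[A in LHS]setIT -integral_indic// integral_tilt.
rewrite -(integral_setCU mN mML ML0)// -[RHS](integral_setCU mM mNLO NLO0)//; last first.
  by move=> x; apply: (cexp_ge0 hf).
rewrite [M `|` (N `|` _)]setUCA; apply: eq_integral => x /set_mem nx.
rewrite cexp_lratio.
have nL : ~ L x by move=> Lx; apply: nx; right; right; left.
have nO : ~ E x by move=> Ox; apply: nx; right; right; right.
have cN0 : cexp nu j f (fun x => (\1_N x)%:E) x = 0.
  by apply: contrapT => c; apply: nO; apply: LE => /= /(_ nL).
have mt (h : p.-tuple R -> \bar R) : measurable_fun setT h ->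
    measurable_fun setT (fun t => h (upd x j t)).
  move=> mh'; apply: measurableT_comp => //.
  by apply: measurable_upd => //; exact: measurable_cst.
have mdt (q : R -> p.-tuple R -> R) : cond_pdf nu j q -> measurable_fun setT (fun t => (q t x)%:E).
  move=> hq; apply/measurable_EFinP; apply: (measurable_cond_pdf_diag hq).
    exact: measurable_id.
  exact: measurable_cst.
have [f0 g0] : (forall t x, 0 <= f t x)%R /\ (forall t x, 0 <= g t x)%R.
  by have [_ f0 _ _] := hf; have [_ g0 _ _] := hg.
have aeN : ae_eq nu setT (fun t => (\1_N (upd x j t))%:E * (f t x)%:E) (cst 0).
  apply/ae_eq_integral_abs => //; first by apply: emeasurable_funM; [exact: (mt _ miN)|exact: mdt].
  rewrite -[RHS]cN0; apply: eq_integral => t _; rewrite gee0_abs//.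
  by rewrite mule_ge0// lee_fin.
transitivity (\int[nu]_t (hA x * (g t x)%:E)).
  rewrite ge0_integralZl//; last 2 first.
    exact: mdt.
    by move=> t _; rewrite lee_fin.
  by have [_ _ _ ->] := hg; rewrite mule1.
apply: ge0_ae_eq_integral => //.
- by apply: measurable_funeM; exact: mdt.
- by apply: emeasurable_funM; [exact: (mt _ mk)|exact: mdt].
- by move=> t _; rewrite mule_ge0// lee_fin.
- by move=> t _; rewrite mule_ge0// lee_fin.
apply: filterS aeN => t /(_ Logic.I) tN _.
have [gz|gz] := eqVneq (g t x) 0%R; first by rewrite gz !mule0.
congr (_ * _); rewrite /k patchE ifT.
  by rewrite /hA (cexp_upd hg).
apply/mem_set => Nt; move/eqP: tN.
rewrite indicE mem_set// mul1e eqe => /eqP fz.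
have : (0 < g t x)%R by rewrite lt_neqAle eq_sym gz g0.
by move/supp; rewrite fz ltxx.
Qed.

End tilt.

(** * One data row *)

Section law.
Context d d' (T : measurableType d) (U : measurableType d') (R : realType).
Variables (P : probability T R) (f : T -> U).
Hypothesis mf : measurable_fun setT f.
Local Open Scope ereal_scope.

Definition law of measurable_fun setT f : set U -> \bar R := pushforward P f.

Let law0 : law mf set0 = 0.
Proof. by rewrite /law /pushforward preimage_set0 measure0. Qed.

Let law_ge0 A : 0 <= law mf A. Proof. exact: measure_ge0. Qed.

Let mpre (A : set U) : measurable A -> measurable (f @^-1` A).
Proof. by move=> mA; rewrite -[X in measurable X]setTI; exact: mf. Qed.

Let law_sigma_additive : semi_sigma_additive (law mf).
Proof.
move=> F mF tF mUF; rewrite /law /pushforward preimage_bigcup.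
apply: measure_semi_sigma_additive; first by move=> n; exact: mpre.
  apply/trivIsetP => /= i j _ _ ij; rewrite -preimage_setI.
  by move/trivIsetP : tF => /(_ _ _ _ _ ij) ->//; rewrite preimage_set0.
by rewrite -preimage_bigcup; exact: mpre.
Qed.

HB.instance Definition _ := isMeasure.Build _ _ _ (law mf)
  law0 law_ge0 law_sigma_additive.

Let lawT : law mf setT = 1.
Proof. by rewrite /law /pushforward preimage_setT probability_setT. Qed.

HB.instance Definition _ := Measure_isProbability.Build _ _ _ (law mf) lawT.

End law.

Section marginal.
Context dx dy (X : measurableType dx) (Y : measurableType dy) (R : realType).
Variable P : probability (X * Y)%type R.
Local Open Scope ereal_scope.

Definition fst_law : probability X R := law P measurable_fst.

Lemma integral_fst_law (h : X -> \bar R) : measurable_fun setT h ->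
  (forall x, 0 <= h x) -> \int[P]_z h z.1 = \int[fst_law]_x h x.
Proof.
move=> mh h0.
exact: (eq_law_integral (m1 := P) (m2 := fst_law) (f1 := fst) (f2 := id)).
Qed.

End marginal.

Section kernel_fst.
Context dx dy dz (X : measurableType dx) (Y : measurableType dy)
  (Z : measurableType dz) (R : realType).
Variable k : R.-pker X ~> Y.
Local Open Scope ereal_scope.

Definition kernel_fst : X * Z -> {measure set Y -> \bar R} := fun z => k z.1.

Let mkernel_fst U : measurable U -> measurable_fun setT (kernel_fst ^~ U).
Proof.
move=> mU; exact: (measurableT_comp (measurable_kernel k U mU) measurable_fst).
Qed.

HB.instance Definition _ := isKernel.Build _ _ _ _ _ kernel_fst mkernel_fst.

Let kernel_fst1 z : kernel_fst z setT = 1. Proof. exact: prob_kernel. Qed.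

HB.instance Definition _ := Kernel_isProbability.Build _ _ _ _ _ kernel_fst kernel_fst1.

End kernel_fst.
Arguments kernel_fst {dx dy dz X Y} Z {R} k.

Section kernel_prob.
Context dx dy (X : measurableType dx) (Y : measurableType dy) (R : realType).
Variables (k : R.-pker X ~> Y) (x : X).

Definition kernel_prob : set Y -> \bar R := k x.

HB.instance Definition _ := Measure.on kernel_prob.

Let kernel_prob1 : kernel_prob setT = 1%E. Proof. exact: prob_kernel. Qed.

HB.instance Definition _ := Measure_isProbability.Build _ _ _ kernel_prob kernel_prob1.

End kernel_prob.

Lemma integral_pkernelC dx d1 d2 (X : measurableType dx) (Y1 : measurableType d1)
    (Y2 : measurableType d2) (R : realType) (k1 : R.-pker X ~> Y1)
    (k2 : R.-pker X ~> Y2) x (f : Y1 * Y2 -> \bar R) :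
  measurable_fun setT f -> (forall z, (0 <= f z)%E) ->
  (\int[k1 x]_y \int[k2 x]_z f (y, z) = \int[k2 x]_z \int[k1 x]_y f (y, z))%E.
Proof.
move=> mf f0.
exact: (@fubini_tonelli _ _ _ _ _ (kernel_prob k1 x) (kernel_prob k2 x) f mf f0).
Qed.

Definition log_ratio (R : realType) (p : nat) (j : 'I_p)
    (f g : R -> p.-tuple R -> R) (r : krow R p) : R :=
  ln ((f (tnth r.1.1 j) r.1.1 * g (tnth r.1.2 j) r.1.1) /
      (g (tnth r.1.1 j) r.1.1 * f (tnth r.1.2 j) r.1.1)).

Lemma swap_row1 (R : realType) (p : nat) (j : 'I_p) (r : krow R p) :
  swap_row [set j]%SET r = (Defs.swap_pair j r.1, r.2).
Proof.
rewrite /swap_row /Defs.swap_pair; congr (_, _, _).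
  by apply: eq_from_tnth => i; rewrite tnth_upd tnth_mktuple finset.in_set1; case: eqP => [->|].
by apply: eq_from_tnth => i; rewrite tnth_upd tnth_mktuple finset.in_set1; case: eqP => [->|].
Qed.

Lemma measurable_swap_pair (R : realType) (p : nat) (j : 'I_p) :
  measurable_fun setT (@Defs.swap_pair R p j).
Proof.
apply: measurable_fun_pair; apply: measurable_upd => //.
  by apply: (measurableT_comp (measurable_tnth j)).
by apply: (measurableT_comp (measurable_tnth j)).
Qed.

Lemma measurable_swap_row1 (R : realType) (p : nat) (j : 'I_p) :
  measurable_fun setT (@swap_row R p [set j]%SET).
Proof.
rewrite (_ : swap_row _ = fun r => (Defs.swap_pair j r.1, r.2)); last first.
  by apply/funext => r; exact: swap_row1.
apply: measurable_fun_pair => //.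
by apply: measurableT_comp => //; exact: measurable_swap_pair.
Qed.

Section row.
Context (R : realType) (p : nat) (nu : {measure set R -> \bar R}) (j : 'I_p).
Variables f g : R -> p.-tuple R -> R.
Hypotheses (hf : cond_pdf nu j f) (hg : cond_pdf nu j g).
Hypothesis supp : forall t x, 0 < f t x <-> 0 < g t x.
Local Notation X := (p.-tuple R).
Variable PXY : probability (X * R)%type R.
Hypothesis hPX : is_cond_pdf_of (fst_law PXY) nu j f.
Variable K : R.-pker X ~> X.
Hypothesis hK : pairwise_exchangeable K nu j g.

Lemma measurable_log_ratio : measurable_fun setT (log_ratio j f g).
Proof.
have [_ f0 _ _] := hf; have [_ g0 _ _] := hg.
have mX1 : measurable_fun setT (fun r : krow R p => r.1.1) by exact: measurableT_comp.
have mX2 : measurable_fun setT (fun r : krow R p => r.1.2) by exact: measurableT_comp.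
have mt1 : measurable_fun setT (fun r : krow R p => tnth r.1.1 j).
  exact: (measurableT_comp (measurable_tnth j)).
have mt2 : measurable_fun setT (fun r : krow R p => tnth r.1.2 j).
  exact: (measurableT_comp (measurable_tnth j)).
apply: (measurableT_comp (@measurable_ln R)).
apply: measurable_funM.
  by apply: measurable_funM; apply: measurable_cond_pdf_diag; try eassumption.
apply: ge0_measurable_funV => [|r]; last exact: mulr_ge0.
by apply: measurable_funM; apply: measurable_cond_pdf_diag; try eassumption.
Qed.

Local Open Scope ereal_scope.

Definition row_mean (F : krow R p -> \bar R) : \bar R :=
  \int[PXY]_z \int[K z.1]_xt F ((z.1, xt), z.2).

Local Notation PX := (fst_law PXY).

Variable kappa : R.-pker X ~> R.
Hypothesis kappa_upd : forall x t B, kappa (upd x j t) B = kappa x B.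
Hypothesis hkappa : forall (A : set X) (B : set R), measurable A -> measurable B ->
  PXY (A `*` B) = \int[PXY]_z ((\1_A z.1)%:E * kappa z.1 B).

Lemma law_semidirect C : measurable C -> PXY C = semidirect PX kappa C.
Proof.
apply: prod_measure_unique.
  by apply: (@le_lt_trans _ _ 1); [exact: probability_le1|exact: ltey].
move=> A B mA mB; rewrite [LHS]hkappa//.
rewrite (integral_fst_law PXY (h := fun x => (\1_A x)%:E * kappa x B)).
- rewrite /semidirect; apply: eq_integral => x _.
  have [xA|xA] := boolP (x \in A).
    by rewrite in_xsectionX// indicE xA mul1e.
  by rewrite notin_xsectionX// indicE (negbTE xA) mul0e measure0.
- apply: emeasurable_funM; first exact: measurable_EFin_indic.
  exact: measurable_kernel.
- by move=> x; rewrite mule_ge0// lee_fin.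
Qed.

Section row_mean_kappa.
Variable F : krow R p -> \bar R.
Hypotheses (mF : measurable_fun setT F) (F0 : forall r, 0 <= F r).

Lemma measurable_row_kappa :
  measurable_fun setT (fun z : X * X => \int[kappa z.1]_y F (z, y)).
Proof. exact: (measurable_fun_integral_fker (kernel_fst X kappa) mF). Qed.

Lemma row_meanE : row_mean F = \int[PX]_x \int[K x]_xt \int[kappa x]_y F ((x, xt), y).
Proof.
pose F' (w : (X * R) * X) := F ((w.1.1, w.2), w.1.2).
have mF' : measurable_fun setT F'.
  apply: measurableT_comp => //; apply: measurable_fun_pair.
    by apply: measurable_fun_pair => //; exact: (measurableT_comp measurable_fst measurable_fst).
  exact: (measurableT_comp measurable_snd measurable_fst).
have mH : measurable_fun setT (fun z : X * R => \int[K z.1]_xt F ((z.1, xt), z.2)).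
  exact: (measurable_fun_integral_fker (kernel_fst R K) mF' (fun=> F0 _)).
have H0 (z : X * R) : 0 <= \int[K z.1]_xt F ((z.1, xt), z.2) by exact: integral_ge0.
rewrite /row_mean (eq_measure_integral (semidirect PX kappa)); last first.
  by move=> C mC _; exact: law_semidirect.
rewrite ge0_integral_semidirect//; apply: eq_integral => x _ /=.
rewrite (integral_pkernelC kappa K x (f := fun w => F ((x, w.2), w.1)))//.
apply: measurableT_comp => //; apply: measurable_fun_pair => //.
apply: measurable_fun_pair => //; exact: measurable_cst.
Qed.

End row_mean_kappa.

Let rho := lratio j g f.

Let supp' t x : (0 < g t x <-> 0 < f t x)%R.
Proof. by have := supp t x; tauto. Qed.

Let mrho : measurable_fun setT (EFin \o rho).
Proof. by apply/measurable_EFinP; exact: (measurable_lratio hg hf). Qed.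

Let rho0 x : 0 <= (rho x)%:E. Proof. by rewrite lee_fin (lratio_ge0 hg hf). Qed.

Let T := tilt hf hg supp hPX.

Lemma integral_tilt_rho (H : X -> \bar R) : measurable_fun setT H ->
  (forall x, 0 <= H x) -> \int[PX]_x H x = \int[T]_x (H x * (rho x)%:E).
Proof.
move=> mH H0.
have [_ f0 _ _] := hf; have [_ g0 _ _] := hg.
pose N := [set x : X | f (tnth x j) x == 0%R].
have mfd : measurable_fun setT (fun x : X => f (tnth x j) x).
  by apply: (measurable_cond_pdf_diag hf) => //; exact: measurable_tnth.
have mN : measurable N.
  have := measurable_fun_eqr mfd (@measurable_cst _ _ X R setT 0%R).
  move=> /(_ measurableT [set true] Logic.I); rewrite setTI.
  by congr measurable; apply/seteqP; split.
have N0 : PX N = 0.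
  rewrite hPX// integral0_eq// => x _; rewrite integral0_eq// => t _.
  rewrite indicE; case: (boolP (_ \in N)) => [/set_mem|]; last by rewrite mul0e.
  rewrite /N /= tnth_upd eqxx (cond_pdf_upd _ _ _ hf) => /eqP ->.
  by rewrite mule0.
have mHr : measurable_fun setT (fun x => H x * (rho x)%:E) by exact: emeasurable_funM mrho.
rewrite integral_tilt//; last by move=> x; rewrite mule_ge0.
apply: ge0_ae_eq_integral => //.
- by apply: emeasurable_funM => //; apply/measurable_EFinP; exact: (measurable_lratio hf hg).
- by move=> x _; rewrite mule_ge0 ?lee_fin ?(lratio_ge0 hf hg)// mule_ge0.
exists N; split => // x /= /not_implyP[_ HN].
apply/negPn/negP => fx; apply: HN; rewrite -muleA -EFinM /rho /lratio.
have gx : g (tnth x j) x != 0%R.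
  by rewrite gt_eqF//; apply/supp; rewrite lt_neqAle eq_sym fx f0.
by rewrite mulrA divfK// divff// mule1.
Qed.

Lemma exchange (G : X * X -> \bar R) : measurable_fun setT G -> (forall z, 0 <= G z) ->
  \int[T]_x \int[K x]_xt G (x, xt) = \int[T]_x \int[K x]_xt G (Defs.swap_pair j (x, xt)).
Proof.
move=> mG G0.
rewrite -(ge0_integral_semidirect T K)//.
rewrite -(ge0_integral_semidirect T K (f := fun z => G (Defs.swap_pair j z)))//; last first.
  by apply: measurableT_comp => //; exact: measurable_swap_pair.
apply: (eq_law_integral (f1 := id)) => //; first exact: measurable_swap_pair.
move=> A mA; rewrite /semidirect.
transitivity (\int[T]_x K x [set xt | A (x, xt)]).
  apply: eq_integral => x _; congr (K x _); apply/seteqP.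
  by split => y; rewrite /xsection /= in_setE.
transitivity (\int[T]_x K x [set xt | A (Defs.swap_pair j (x, xt))]).
  exact: (hK (tilt_cond_pdf hf hg supp hPX) mA).
apply: eq_integral => x _; congr (K x _); apply/seteqP.
by split => y; rewrite /xsection /= in_setE.
Qed.

Lemma lratio_swap_le x xt y :
  (lratio j f g x * rho (upd x j (tnth xt j)) <=
   expR (log_ratio j f g (Defs.swap_pair j (x, xt), y)))%R.
Proof.
have [_ f0 _ _] := hf; have [_ g0 _ _] := hg.
rewrite /log_ratio /rho /lratio /= !tnth_upd !eqxx !(cond_pdf_upd _ _ _ hf).
rewrite !(cond_pdf_upd _ _ _ hg).
set a := f (tnth x j) x; set b := g (tnth x j) x.
set c := f (tnth xt j) x; set e := g (tnth xt j) x.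
have [az|a0] := eqVneq a 0%R; first by rewrite az invr0 mulr0 mul0r expR_ge0.
have [ez|e0] := eqVneq e 0%R; first by rewrite ez invr0 !mulr0 expR_ge0.
have ap : (0 < a)%R by rewrite lt_neqAle eq_sym a0 f0.
have ep : (0 < e)%R by rewrite lt_neqAle eq_sym e0 g0.
have bp : (0 < b)%R by apply/supp.
have cp : (0 < c)%R by apply/supp.
rewrite lnK ?posrE ?divr_gt0 ?mulr_gt0//.
by rewrite invfM [leRHS]mulrACA [leRHS]mulrC lexx.
Qed.

Lemma row_mean_swap_le (F : krow R p -> \bar R) :
  measurable_fun setT F -> (forall r, 0 <= F r) ->
  row_mean F <= row_mean (fun r => F (swap_row [set j]%SET r) *
    (expR (log_ratio j f g (swap_row [set j]%SET r)))%:E).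
Proof.
move=> mF F0.
have msw := @measurable_swap_row1 R p j.
have mE : measurable_fun setT (fun r : krow R p => F (swap_row [set j]%SET r) *
    (expR (log_ratio j f g (swap_row [set j]%SET r)))%:E).
  apply: emeasurable_funM; first exact: measurableT_comp.
  apply/measurable_EFinP; apply: (measurableT_comp (@measurable_expR R)).
  by apply: measurableT_comp => //; exact: measurable_log_ratio.
have E0 (r : krow R p) : 0 <= F (swap_row [set j]%SET r) *
    (expR (log_ratio j f g (swap_row [set j]%SET r)))%:E.
  by rewrite mule_ge0// lee_fin expR_ge0.
rewrite (row_meanE mF F0) (row_meanE mE E0).
pose G (z : X * X) := \int[kappa z.1]_y F (z, y).
have mG : measurable_fun setT G by exact: measurable_row_kappa.
have G0 z : 0 <= G z by exact: integral_ge0.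
have ms (H : X * X -> \bar R) x : measurable_fun setT H ->
    measurable_fun setT (fun y => H (x, y)).
  by move=> mH; apply: measurableT_comp => //; exact: measurable_pair1.
have mKG : measurable_fun setT (fun x => \int[K x]_xt G (x, xt)).
  exact: (measurable_fun_integral_fker K mG).
have KG0 x : 0 <= \int[K x]_xt G (x, xt) by exact: integral_ge0.
rewrite -[leLHS]/(\int[PX]_x \int[K x]_xt G (x, xt)).
rewrite (integral_tilt_rho mKG KG0).
have mGr : measurable_fun setT (fun z => (rho z.1)%:E * G z).
  by apply: emeasurable_funM => //; exact: (measurableT_comp mrho).
have Gr0 (z : X * X) : 0 <= (rho z.1)%:E * G z by rewrite mule_ge0.
under eq_integral => x _.
  rewrite muleC -ge0_integralZl//; last exact: ms.
  over.
rewrite (exchange mGr Gr0).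
have mGs : measurable_fun setT
    (fun z : X * X => (rho (Defs.swap_pair j z).1)%:E * G (Defs.swap_pair j z)).
  apply: (measurableT_comp mGr); exact: measurable_swap_pair.
have mKGs : measurable_fun setT (fun x =>
    \int[K x]_xt ((rho (Defs.swap_pair j (x, xt)).1)%:E * G (Defs.swap_pair j (x, xt)))).
  exact: (measurable_fun_integral_fker K mGs).
have KGs0 x :
    0 <= \int[K x]_xt ((rho (Defs.swap_pair j (x, xt)).1)%:E * G (Defs.swap_pair j (x, xt))).
  by apply: integral_ge0 => xt _; exact: Gr0.
rewrite (integral_tilt hf hg supp hPX mKGs KGs0).
apply: ge0_le_integral => //.
- by move=> x _; rewrite mule_ge0 ?lee_fin ?(lratio_ge0 hf hg)// integral_ge0.
- apply: emeasurable_funM; first exact: (measurable_fun_integral_fker K mGs).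
  by apply/measurable_EFinP; exact: (measurable_lratio hf hg).
- apply: (measurable_fun_integral_fker K (measurable_row_kappa mE E0)) => z.
  by apply: integral_ge0 => y _; exact: E0.
move=> x _; rewrite muleC -ge0_integralZl//; last 2 first.
- exact: (ms _ x mGs).
- by rewrite lee_fin (lratio_ge0 hf hg).
apply: ge0_le_integral => //.
- by move=> xt _; rewrite mule_ge0// lee_fin (lratio_ge0 hf hg).
- by apply: measurable_funeM; exact: (ms _ x mGs).
- exact: (ms _ x (measurable_row_kappa mE E0)).
move=> xt _.
rewrite [G _](_ : _ = \int[kappa x]_y F (Defs.swap_pair j (x, xt), y)); last first.
  rewrite /G; apply: eq_measure_integral => B mB _; exact: kappa_upd.
have mFs : measurable_fun setT (fun y => F (Defs.swap_pair j (x, xt), y)).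
  by apply: measurableT_comp => //; exact: measurable_pair1.
rewrite muleA -EFinM -ge0_integralZl//; last first.
- by rewrite lee_fin mulr_ge0 ?(lratio_ge0 hf hg)// (lratio_ge0 hg hf).
apply: ge0_le_integral => //.
- by move=> y _; rewrite mule_ge0// lee_fin mulr_ge0 ?(lratio_ge0 hf hg)// (lratio_ge0 hg hf).
- exact: measurable_funeM.
- by apply: (measurableT_comp mE); exact: measurable_pair1.
move=> y _; rewrite swap_row1 /= muleC; apply: lee_wpmul2l => //.
by rewrite lee_fin; exact: lratio_swap_le.
Qed.

End row.

(** * Independent rows *)

Section tuple_measure.
Context d (T : measurableType d) (n : nat) (R : realType).

Definition box (B : 'I_n -> set T) : set (n.-tuple T) :=
  [set D | forall i, B i (tnth D i)].

Lemma measurable_box B : (forall i, measurable (B i)) -> measurable (box B).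
Proof.
move=> mB; rewrite (_ : box B = \bigcap_(i in [set: 'I_n]) ((fun D => tnth D i) @^-1` B i)).
  apply: fin_bigcap_measurable => // i _.
  by rewrite -[X in measurable X]setTI; exact: measurable_tnth.
by apply/seteqP; split => D; [move=> h i _; exact: h|move=> h i; exact: (h i)].
Qed.

Lemma measurable_tuple_boxes :
  @measurable _ (n.-tuple T) =
  <<s [set box B | B in [set B | forall i, measurable (B i)]] >>.
Proof.
apply/seteqP; split.
  apply: smallest_sub; first exact: smallest_sigma_algebra.
  move=> A; rewrite -bigcup_seq => -[i _ [B mB <-]].
  apply: sub_sigma_algebra; exists (fun k => if k == i then B else setT).
    by move=> k; case: ifP.
  apply/seteqP; split => D /=.
    by move=> /(_ i); rewrite eqxx.
  by move=> [_ Di] k; case: eqP => [->|].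
apply: smallest_sub; first exact: sigma_algebra_measurable.
by move=> _ [B mB <-]; exact: measurable_box.
Qed.

Lemma tuple_measure_unique (m1 m2 : {measure set (n.-tuple T) -> \bar R}) :
  (m1 setT < +oo)%E ->
  (forall B, (forall i, measurable (B i)) -> m1 (box B) = m2 (box B)) ->
  forall C, measurable C -> m1 C = m2 C.
Proof.
move=> m1oo m12 C mC.
apply: (measure_unique [set box B | B in [set B | forall i, measurable (B i)]]
  (fun=> setT)) => //.
- exact: measurable_tuple_boxes.
- move=> _ _ [A mA <-] [B mB <-]; exists (fun i => A i `&` B i).
    by move=> i; exact: measurableI.
  apply/seteqP; split => D; first by move=> h; split => i; have [] := h i.
  by move=> [hA hB] i; split; [exact: hA|exact: hB].
- by move=> _; exists (fun=> setT) => //; apply/seteqP; split.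
- by rewrite bigcup_const//; exists 0%N.
- by move=> _ [B mB <-]; exact: m12.
Qed.

End tuple_measure.

Section data.
Context (R : realType) (p n : nat) (d : measure_display) (Omega : measurableType d).
Variables (P : probability Omega R) (PXY : probability (p.-tuple R * R)%type R).
Variables (K : R.-pker (p.-tuple R) ~> (p.-tuple R)) (Z : 'I_n -> Omega -> krow R p).
Hypothesis hZ : knockoff_data P PXY K Z.

Let mZ i : measurable_fun setT (Z i). Proof. by have [] := hZ. Qed.

Lemma measurable_data_of : measurable_fun setT (data_of Z).
Proof.
apply/measurable_fun_tnthP => i; rewrite (_ : _ \o _ = Z i)//.
by apply/funext => om /=; rewrite tnth_mktuple.
Qed.

Local Open Scope ereal_scope.

Lemma integral_row i (F : krow R p -> \bar R) : measurable_fun setT F ->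
  (forall r, 0 <= F r) -> \int[P]_om F (Z i om) = row_mean PXY K F.
Proof.
move=> mF F0.
pose arr (w : (p.-tuple R * R) * p.-tuple R) : krow R p := ((w.1.1, w.2), w.1.2).
have marr : measurable_fun setT arr.
  apply: measurable_fun_pair; last exact: (measurableT_comp measurable_snd measurable_fst).
  by apply: measurable_fun_pair => //; exact: (measurableT_comp measurable_fst measurable_fst).
rewrite (eq_law_integral (m2 := semidirect PXY (kernel_fst R K)) (mZ i) marr)//.
  rewrite (ge0_integral_semidirect _ _ (f := fun w => F (arr w)))//.
  exact: measurableT_comp.
move=> A mA; have [_ lawZ _] := hZ; rewrite [LHS]lawZ//.
apply: eq_integral => z _; congr (K z.1 _).
by apply/seteqP; split => xt; rewrite /xsection /= in_setE.
Qed.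

Let resample i (w : Omega * Omega) := upd (data_of Z w.1) i (Z i w.2).

Let mresample i : measurable_fun setT (resample i).
Proof.
apply: measurable_upd; first exact: (measurableT_comp measurable_data_of measurable_fst).
exact: (measurableT_comp (mZ i) measurable_snd).
Qed.

Lemma law_resample i C : measurable C ->
  P (data_of Z @^-1` C) = (P \x P) (resample i @^-1` C).
Proof.
apply: (tuple_measure_unique (m1 := law P measurable_data_of)
                             (m2 := law (P \x P) (mresample i))).
  by apply: (@le_lt_trans _ _ 1); [exact: probability_le1|exact: ltey].
move=> B mB; have [_ _ ind] := hZ.
have mZB (B' : 'I_n -> set (krow R p)) k :
    (forall k, measurable (B' k)) -> measurable (Z k @^-1` B' k).
  by move=> mB'; rewrite -[X in measurable X]setTI; exact: mZ.
have boxE (B' : 'I_n -> set (krow R p)) :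
    data_of Z @^-1` box B' = [set om | forall i, B' i (Z i om)].
  by apply/seteqP; split => om h k; have := h k; rewrite /= tnth_mktuple.
pose B' k := if k == i then setT else B k.
have mB' k : measurable (B' k) by rewrite /B'; case: ifP.
transitivity (P (data_of Z @^-1` box B)) => //.
transitivity ((P \x P) ((data_of Z @^-1` box B') `*` (Z i @^-1` B i))); last first.
  congr ((P \x P) _); apply/seteqP; split => -[om om'] /=.
    move=> [h1 h2] k; rewrite tnth_upd; case: eqP => [->//|/eqP ki].
    by have := h1 k; rewrite /B' (negbTE ki).
  move=> h; split => [k|]; last by have := h i; rewrite /= tnth_upd eqxx.
  rewrite /B'; case: eqP => // /eqP ki.
  by have := h k; rewrite /= tnth_upd (negbTE ki).
rewrite product_measure1E; last 2 first.
- rewrite -[X in measurable X]setTI; apply: measurable_data_of => //.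
  exact: measurable_box.
- exact: mZB.
rewrite !boxE ind// [X in _ = X * _]ind//.
rewrite (bigD1 i)//= [in RHS](bigD1 i)//= {1}/B' eqxx preimage_setT probability_setT mul1e muleC.
by congr (_ * _); apply: eq_bigr => k ki; rewrite /B' (negbTE ki).
Qed.

Lemma integral_resample i (F : n.-tuple (krow R p) -> \bar R) :
  measurable_fun setT F -> (forall D, 0 <= F D) ->
  \int[P]_om F (data_of Z om) =
  \int[P]_om \int[P]_om' F (upd (data_of Z om) i (Z i om')).
Proof.
move=> mF F0.
rewrite (eq_law_integral (m2 := P \x P) measurable_data_of (mresample i))//; last first.
  exact: law_resample.
rewrite (@fubini_tonelli1 _ _ _ _ _ P P (fun w => F (resample i w)))//.
exact: measurableT_comp.
Qed.

Section swap.
Variables (j : 'I_p) (f g : R -> p.-tuple R -> R).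
Local Notation s := (swap_row [set j]%SET).
Local Notation E r := (expR (log_ratio j f g r)).
Hypothesis mE : measurable_fun setT (log_ratio j f g).
Hypothesis row_le : forall F : krow R p -> \bar R, measurable_fun setT F ->
  (forall r, 0 <= F r) ->
  row_mean PXY K F <= row_mean PXY K (fun r => F (s r) * (E (s r))%:E).

Let ms : measurable_fun setT (s : krow R p -> krow R p).
Proof. exact: measurable_swap_row1. Qed.

Let mEs : measurable_fun setT (fun r : krow R p => E (s r)).
Proof.
apply: (measurableT_comp (@measurable_expR R)).
exact: (measurableT_comp mE ms).
Qed.

Lemma integral_swap_one i (F : n.-tuple (krow R p) -> \bar R) :
  measurable_fun setT F -> (forall D, 0 <= F D) ->
  \int[P]_om F (data_of Z om) <=
  \int[P]_om (F (upd (data_of Z om) i (s (Z i om))) * (E (s (Z i om)))%:E).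
Proof.
move=> mF F0.
pose G (D : n.-tuple (krow R p)) := F (upd D i (s (tnth D i))) * (E (s (tnth D i)))%:E.
have mG : measurable_fun setT G.
  apply: emeasurable_funM.
    apply: measurableT_comp => //; apply: measurable_upd => //.
    exact: (measurableT_comp ms (measurable_tnth i)).
  apply/measurable_EFinP; exact: (measurableT_comp mEs (measurable_tnth i)).
have G0 D : 0 <= G D by rewrite mule_ge0// lee_fin expR_ge0.
rewrite [leRHS](_ : _ = \int[P]_om G (data_of Z om)); last first.
  by apply: eq_integral => om _; rewrite /G tnth_mktuple.
rewrite (integral_resample i mF F0) (integral_resample i mG G0).
have mint (H : n.-tuple (krow R p) -> \bar R) :
    measurable_fun setT H -> (forall D, 0 <= H D) ->
    measurable_fun setT (fun om => \int[P]_om' H (upd (data_of Z om) i (Z i om'))).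
  move=> mH H0.
  have mHr : measurable_fun setT (fun w => H (resample i w)) by exact: measurableT_comp.
  exact: (measurable_fun_fubini_tonelli_F (m2 := P) _ mHr (fun=> H0 _)).
apply: ge0_le_integral => //.
- by move=> om _; exact: integral_ge0.
- exact: mint.
- exact: mint.
move=> om _.
have mu (H : n.-tuple (krow R p) -> \bar R) : measurable_fun setT H ->
    measurable_fun setT (fun r => H (upd (data_of Z om) i r)).
  move=> mH; apply: measurableT_comp => //.
  by apply: measurable_upd => //; exact: measurable_cst.
rewrite (integral_row i (mu _ mF))// (integral_row i (mu _ mG))//.
apply: (le_trans (row_le (mu _ mF) (fun=> F0 _))).
rewrite le_eqVlt; apply/orP; left; apply/eqP; rewrite /row_mean.
apply: eq_integral => z _; apply: eq_integral => xt _.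
by rewrite /G upd_upd tnth_upd eqxx.
Qed.

Let swap_rows (l : seq 'I_n) (D : n.-tuple (krow R p)) : n.-tuple (krow R p) :=
  [tuple if i \in l then s (tnth D i) else tnth D i | i < n].

Let measurable_swap_rows l : measurable_fun setT (swap_rows l).
Proof.
apply/measurable_fun_tnthP => i.
rewrite (_ : _ \o _ = fun D => if i \in l then s (tnth D i) else tnth D i); last first.
  by apply/funext => D /=; rewrite tnth_mktuple.
case: (i \in l); last exact: measurable_tnth.
exact: (measurableT_comp ms (measurable_tnth i)).
Qed.

Lemma integral_swap_rows l (F : n.-tuple (krow R p) -> \bar R) : uniq l ->
  measurable_fun setT F -> (forall D, 0 <= F D) ->
  \int[P]_om F (data_of Z om) <=
  \int[P]_om (F (swap_rows l (data_of Z om)) * (\prod_(i <- l) E (s (Z i om)))%:E).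
Proof.
elim: l => [_|i l ih /= /andP[il ul]] mF F0.
  rewrite le_eqVlt; apply/orP; left; apply/eqP; apply: eq_integral => om _.
  rewrite big_nil mule1; congr F; apply: eq_from_tnth => k.
  by rewrite [RHS]tnth_mktuple.
apply: (le_trans (ih ul mF F0)).
pose G (D : n.-tuple (krow R p)) :=
  F (swap_rows l D) * (\prod_(i <- l) E (s (tnth D i)))%:E.
have mG : measurable_fun setT G.
  apply: emeasurable_funM; first exact: measurableT_comp.
  apply/measurable_EFinP; apply: measurable_prod => k _.
  exact: (measurableT_comp mEs (measurable_tnth k)).
have G0 D : 0 <= G D by rewrite mule_ge0// lee_fin prodr_ge0// => k _; exact: expR_ge0.
rewrite [leLHS](_ : _ = \int[P]_om G (data_of Z om)); last first.
  apply: eq_integral => om _; congr (_ * (_)%:E).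
  by apply: eq_bigr => k _; rewrite tnth_mktuple.
apply: (le_trans (integral_swap_one i mG G0)).
rewrite le_eqVlt; apply/orP; left; apply/eqP; apply: eq_integral => om _.
rewrite /G -muleA big_cons mulrC EFinM; congr (F _ * (_%:E * _)).
  apply: eq_from_tnth => k; rewrite !tnth_mktuple in_cons.
  by case: eqP => [->|]//=; rewrite (negbTE il).
rewrite big_seq [RHS]big_seq; apply: eq_bigr => k kl.
rewrite tnth_upd; case: eqP => [ki|_]; last by rewrite tnth_mktuple.
by rewrite -ki kl in il.
Qed.

End swap.

Lemma integral_swap_data (Pc Qc : 'I_p -> R -> p.-tuple R -> R) j
  (F : n.-tuple (krow R p) -> \bar R) :
  measurable_fun setT (log_ratio j (Pc j) (Qc j)) ->
  (forall F : krow R p -> \bar R, measurable_fun setT F -> (forall r, 0 <= F r) ->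
    row_mean PXY K F <= row_mean PXY K (fun r => F (swap_row [set j]%SET r) *
      (expR (log_ratio j (Pc j) (Qc j) (swap_row [set j]%SET r)))%:E)) ->
  measurable_fun setT F -> (forall D, 0 <= F D) ->
  \int[P]_om F (data_of Z om) <=
  \int[P]_om (F (swap_data [set j]%SET (data_of Z om)) *
    (expR (KLhat Pc Qc j (swap_data [set j]%SET (data_of Z om))))%:E).
Proof.
move=> mE row_le mF F0.
apply: (le_trans (integral_swap_rows mE row_le (enum_uniq 'I_n) mF F0)).
rewrite le_eqVlt; apply/orP; left; apply/eqP; apply: eq_integral => om _.
congr (F _ * _%:E).
  by apply: eq_from_tnth => k; rewrite !tnth_mktuple mem_enum.
rewrite big_enum/= /KLhat expR_sum; apply: eq_bigr => k _.
rewrite [tnth (swap_data _ _) k]tnth_mktuple [tnth (data_of _ _) k]tnth_mktuple.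
by [].
Qed.

End data.

(** * The knockoff filter *)

Section filter.
Context (R : realType) (p : nat) (plus : bool) (q : R).
Hypothesis q0 : 0 < q.
Implicit Types (W V : 'I_p -> R) (j k : 'I_p) (t : R).

Local Notation ok := (thr_ok plus q).
Local Notation sel := (selected plus q).

Definition thr_min W k : bool :=
  ok W `|W k| && [forall k', ok W `|W k'| ==> (`|W k| <= `|W k'|)].

(* [{j : W_j <= - T}], the mirror image of [selected]. *)
Definition neg_selected W : {set 'I_p} :=
  [set j | [exists k, thr_min W k && (W j <= - `|W k|)]]%SET.

Definition abs_at j W : 'I_p -> R := fun k => if k == j then `|W k| else W k.

Lemma selectedP W j :
  reflect (exists2 k, thr_min W k & `|W k| <= W j) (j \in sel W).
Proof.
rewrite finset.inE; apply: (iffP existsP) => [[k /and3P[a b c]]|[k /andP[a b] c]];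
  exists k => //; first by rewrite /thr_min a b.
by rewrite a b c.
Qed.

Lemma thr_min_unique W k k' : thr_min W k -> thr_min W k' -> `|W k| = `|W k'|.
Proof.
move=> /andP[a /forallP b] /andP[a' /forallP b']; apply/eqP; rewrite eq_le.
by rewrite (implyP (b k') a') (implyP (b' k) a).
Qed.

Lemma thr_min_gt0 W k : thr_min W k -> 0 < `|W k|.
Proof. by case/andP => /and4P[]. Qed.

Lemma selectedE W k : thr_min W k -> sel W = [set j | `|W k| <= W j]%SET.
Proof.
move=> mk; apply/setP => j; apply/selectedP/idP.
  by move=> [k' mk' h]; rewrite finset.inE (thr_min_unique mk mk').
by rewrite finset.inE => h; exists k.
Qed.

Lemma neg_selectedE W k : thr_min W k ->
  neg_selected W = [set j | W j <= - `|W k|]%SET.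
Proof.
move=> mk; apply/setP => j; rewrite !finset.inE; apply/existsP/idP.
  by move=> [k' /andP[mk' h]]; rewrite (thr_min_unique mk mk').
by move=> h; exists k; rewrite mk.
Qed.

Lemma abs_at_abs j W k : `|abs_at j W k| = `|W k|.
Proof. by rewrite /abs_at; case: ifP => // _; rewrite normr_id. Qed.

Lemma abs_at_id j W : 0 <= W j -> abs_at j W = W.
Proof.
by move=> Wj; apply/funext => k; rewrite /abs_at; case: eqP => [->|//]; rewrite ger0_norm.
Qed.

Lemma selected_gt0 W j : j \in sel W -> 0 < W j.
Proof. by move=> /selectedP[k mk]; apply: lt_le_trans; exact: thr_min_gt0 mk. Qed.

Lemma selected_abs_at W j :
  (j \in sel W) = (0 < W j) && (j \in sel (abs_at j W)).
Proof.
have [Wj|Wj] := ltP 0 (W j); first by rewrite abs_at_id// ltW.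
by apply/negbTE/negP => /selected_gt0; rewrite ltNge Wj.
Qed.

Lemma thr_ok_abs_at W j k t : W j < 0 -> W k < 0 -> t <= `|W j| -> t <= `|W k| ->
  ok (abs_at j W) t -> ok (abs_at k W) t.
Proof.
move=> Wj Wk tj tk /and4P[t0 tW].
have pos i : W i < 0 -> t <= `|W i| ->
    #|[pred l | t <= abs_at i W l]| = #|[set l | t <= W l]%SET|.+1.
  move=> Wi ti; transitivity #|(i |: [set l | t <= W l])%SET|.
    apply: eq_card => l; rewrite !finset.inE /abs_at; case: eqP => [->|//].
    by rewrite ti.
  by rewrite cardsU1 finset.inE leNgt (lt_trans Wi t0).
have neg i : W i < 0 -> t <= `|W i| ->
    #|[pred l | abs_at i W l <= - t]| = #|[set l | W l <= - t]%SET|.-1.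
  move=> Wi ti; transitivity #|([set l | W l <= - t] :\ i)%SET|.
    apply: eq_card => l; rewrite !finset.inE /abs_at; case: eqP => [->|//].
    by apply/negbTE; rewrite -ltNge (lt_le_trans _ (normr_ge0 _))// oppr_lt0.
  by rewrite [in RHS](cardsD1 i) finset.inE lerNr -(ltr0_norm Wi) ti.
rewrite !(pos j)// !(neg j)// => c1 c2.
rewrite /thr_ok t0 !(pos k)// !(neg k)// c1 c2 /= andbT.
have /existsP[l /eqP hl] := tW; apply/existsP; exists l.
by rewrite abs_at_abs -hl abs_at_abs.
Qed.

(* The leave-one-out thresholds [T_j] of those [j] with [W_j <= - T_j] coincide. *)
Lemma thr_min_abs_at W j k a b : W j < 0 -> W k < 0 ->
  thr_min (abs_at j W) a -> thr_min (abs_at k W) b ->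
  `|W a| <= `|W j| -> `|W b| <= `|W k| -> `|W a| = `|W b|.
Proof.
move=> Wj Wk /andP[oka /forallP mina] /andP[okb /forallP minb] aj bk.
rewrite !abs_at_abs in oka okb.
have [ab|ba] := leP `|W a| `|W b|.
  apply/eqP; rewrite eq_le ab /=.
  have /implyP := minb a; rewrite !abs_at_abs; apply.
  by apply: thr_ok_abs_at oka => //; exact: le_trans ab bk.
apply/eqP; rewrite eq_le (ltW ba) andbT.
have /implyP := mina b; rewrite !abs_at_abs; apply.
by apply: thr_ok_abs_at okb => //; exact: le_trans (ltW ba) aj.
Qed.

(* [1{|W_j| >= T_j} / (1 + #{k != j : W_k <= - T_j})], where [T_j] is the threshold
   of [abs_at j W]. *)
Definition weight j W : R :=
  (j \in sel (abs_at j W))%:R / (1 + #|neg_selected (abs_at j W)|%:R).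

Lemma weight_ge0 j W : 0 <= weight j W.
Proof. by rewrite divr_ge0// addr_ge0. Qed.

Lemma sum_neg_weight_le1 W : \sum_j (W j < 0)%R%:R * weight j W <= 1.
Proof.
pose A := [set j | (W j < 0) && (j \in sel (abs_at j W))]%SET.
have AP j : j \in A -> exists2 a, thr_min (abs_at j W) a & `|W a| <= `|W j|.
  rewrite finset.inE => /andP[_ /selectedP[a ma h]]; exists a => //.
  by move: h; rewrite abs_at_abs /abs_at eqxx.
have A0 j : j \in A -> W j < 0 by rewrite finset.inE => /andP[].
have cardA j : j \in A -> (#|A| <= 1 + #|neg_selected (abs_at j W)|)%N.
  move=> jA; have [a ma aj] := AP _ jA.
  rewrite (cardsD1 j) jA leq_add2l; apply: subset_leq_card; apply/fintype.subsetP => k.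
  rewrite finset.in_setD1 => /andP[kj kA].
  have [b mb bk] := AP _ kA.
  rewrite finset.inE; apply/existsP; exists a; rewrite ma /= abs_at_abs /abs_at (negbTE kj).
  rewrite (thr_min_abs_at (A0 _ jA) (A0 _ kA) ma mb aj bk).
  by rewrite lerNr -(ltr0_norm (A0 _ kA)).
rewrite (bigID [in A])/= [X in _ + X]big1 ?addr0; last first.
  move=> j; rewrite finset.inE negb_and => /orP[/negbTE ->|/negbTE h].
    by rewrite mul0r.
  by rewrite /weight h mul0r mulr0.
have [A00|Agt0] := posnP #|A|.
  by rewrite big1// => j jA; have := cards0_eq A00 => AE; rewrite AE finset.inE in jA.
apply: (@le_trans _ _ (\sum_(j in A) (#|A|%:R)^-1)).
  apply: ler_sum => j jA; have := jA; rewrite finset.inE => /andP[Wj sj].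
  rewrite Wj /weight sj mul1r div1r -[1 in X in X^-1]/(1%:R) -natrD.
  by rewrite lef_pV2 ?posrE ?ltr0n// ler_nat cardA.
by rewrite sumr_const -[_ *+ _]mulr_natr mulVf// pnatr_eq0 -lt0n.
Qed.

Lemma ratio_le W (c : nat) : (c <= #|sel W|)%N ->
  c%:R / (if plus then (maxn #|sel W| 1)%:R else #|sel W|%:R + q^-1) <=
  q * (c%:R / (1 + #|neg_selected W|%:R)).
Proof.
move=> cS; have [S0|/card_gt0P[j /selectedP[k mk _]]] := posnP #|sel W|.
  by move: cS; rewrite S0 leqn0 => /eqP ->; rewrite !mul0r mulr0.
have npos : 0 < 1 + #|neg_selected W|%:R :> R by rewrite ltr_pwDl.
rewrite [q * _]mulrCA; apply: ler_wpM2l => //.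
have selE : #|[pred j | `|W k| <= W j]| = #|sel W|.
  by rewrite (selectedE mk); apply: eq_card => l; rewrite !finset.inE.
have negE : #|[pred j | W j <= - `|W k|]| = #|neg_selected W|.
  by rewrite (neg_selectedE mk); apply: eq_card => l; rewrite !finset.inE.
have /andP[/and4P[t0 _]] := mk; rewrite selE negE => Spos.
rewrite ler_pdivrMr ?ltr0n// => hq _.
rewrite ler_pdivlMr//.
move: #|sel W| #|neg_selected W| Spos hq {npos cS selE negE} => s m Spos.
case: plus => /= hq.
  have -> : maxn s 1 = s by apply/maxn_idPl.
  by rewrite mulrC ler_pdivrMr ?ltr0n.
rewrite mulrC ler_pdivrMr; last by rewrite addr_gt0 ?ltr0n// invr_gt0.
by rewrite mulrDr mulfV ?gt_eqF// addrC lerD2r -[X in X <= _]add0r.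
Qed.

End filter.

Section finite_valued.
Context d (T : measurableType d) (R : realType).

Definition fin_measurable (U : finType) (X : T -> U) : Prop :=
  forall a, measurable [set x | X x = a].

Lemma fin_measurable_preimage (U : finType) (X : T -> U) (A : set U) :
  fin_measurable X -> measurable (X @^-1` A).
Proof.
move=> mX; rewrite (_ : _ @^-1` _ = \bigcup_(a in A) [set x | X x = a]).
  by apply: fin_bigcup_measurable => // a _; exact: mX.
apply/seteqP; split => x /=; first by move=> AX; exists (X x).
by move=> [a Aa /= ->].
Qed.

Lemma fin_measurable_comp (U V : finType) (h : U -> V) (X : T -> U) :
  fin_measurable X -> fin_measurable (fun x => h (X x)).
Proof. by move=> mX b; exact: (fin_measurable_preimage (h @^-1` [set b]) mX). Qed.

Lemma fin_measurable_fun d' (V : measurableType d') (U : finType) (h : U -> V)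
    (X : T -> U) : fin_measurable X -> measurable_fun setT (fun x => h (X x)).
Proof.
by move=> mX _ B _; rewrite setTI; exact: (fin_measurable_preimage (h @^-1` B) mX).
Qed.

Lemma fin_measurable_pair (U V : finType) (X : T -> U) (Y : T -> V) :
  fin_measurable X -> fin_measurable Y -> fin_measurable (fun x => (X x, Y x)).
Proof.
move=> mX mY [a b].
rewrite (_ : [set _ | _] = [set x | X x = a] `&` [set x | Y x = b]).
  exact: measurableI.
by apply/seteqP; split => x /= [-> ->].
Qed.

Lemma fin_measurable_comp2 (U V U' : finType) (h : U -> V -> U') (X : T -> U)
    (Y : T -> V) :
  fin_measurable X -> fin_measurable Y -> fin_measurable (fun x => h (X x) (Y x)).
Proof.
move=> mX mY.
exact: (fin_measurable_comp (fun u => h u.1 u.2) (fin_measurable_pair mX mY)).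
Qed.

Lemma fin_measurable_bool (b : T -> bool) :
  measurable_fun setT b -> fin_measurable b.
Proof.
by move=> mb a; have := mb measurableT [set a] Logic.I; rewrite setTI.
Qed.

Lemma measurable_bool_natr (b : T -> bool) :
  measurable_fun setT b -> measurable_fun setT (fun x => (b x)%:R : R).
Proof.
move=> mb.
exact: (fin_measurable_fun (fun c : bool => c%:R : R) (fin_measurable_bool mb)).
Qed.

Lemma fin_measurable_set (I : finType) (b : I -> T -> bool) :
  (forall i, fin_measurable (b i)) ->
  fin_measurable (fun x => [set i | b i x]%SET).
Proof.
move=> mb A.
rewrite (_ : [set _ | _] = \bigcap_(i in [set: I]) [set x | b i x = (i \in A)]).
  by apply: fin_bigcap_measurable => // i _; exact: mb.
apply/seteqP; split => x /=; first by move=> <- i _ /=; rewrite finset.inE.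
by move=> h; apply/setP => i; rewrite finset.inE; exact: h.
Qed.

Lemma fin_measurable_exists (I : finType) (b : I -> T -> bool) :
  (forall i, fin_measurable (b i)) -> fin_measurable (fun x => [exists i, b i x]).
Proof.
move=> mb; rewrite (_ : (fun x => _) = (fun x => [exists i, i \in [set i | b i x]%SET])).
  exact: (fin_measurable_comp (fun A : {set I} => [exists i, i \in A])
    (fin_measurable_set mb)).
by apply/funext => x; apply: eq_existsb => i; rewrite finset.inE.
Qed.

Lemma fin_measurable_forall (I : finType) (b : I -> T -> bool) :
  (forall i, fin_measurable (b i)) -> fin_measurable (fun x => [forall i, b i x]).
Proof.
move=> mb; rewrite (_ : (fun x => _) = (fun x => [forall i, i \in [set i | b i x]%SET])).
  exact: (fin_measurable_comp (fun A : {set I} => [forall i, i \in A])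
    (fin_measurable_set mb)).
by apply/funext => x; apply: eq_forallb => i; rewrite finset.inE.
Qed.

Section selected.
Variables (p : nat) (plus : bool) (q : R).

Lemma fin_measurable_thr_ok (V : T -> 'I_p -> R) (t : T -> R) :
  (forall k, measurable_fun setT (V ^~ k)) -> measurable_fun setT t ->
  fin_measurable (fun x => thr_ok plus q (V x) (t x)).
Proof.
move=> mV mt; rewrite /thr_ok.
apply: fin_measurable_comp2.
  by apply: fin_measurable_bool; apply: measurable_fun_ltr.
apply: fin_measurable_comp2.
  apply: fin_measurable_exists => k; apply: fin_measurable_bool.
  by apply: measurable_fun_eqr => //; exact: measurableT_comp.
pose A x := [set j | t x <= V x j]%SET.
pose B x := [set j | V x j <= - t x]%SET.
have mA : fin_measurable A.
  by apply: fin_measurable_set => j; apply: fin_measurable_bool; exact: measurable_fun_ler.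
have mB : fin_measurable B.
  apply: fin_measurable_set => j; apply: fin_measurable_bool; apply: measurable_fun_ler => //.
  exact: measurableT_comp.
rewrite (_ : (fun x => _) = fun x => (0 < #|A x|)%N &&
    ((plus%:R + #|B x|%:R) / #|A x|%:R <= q)); last first.
  by apply/funext => x; rewrite !cardsE.
exact: (fin_measurable_comp2 (fun A B : {set 'I_p} => (0 < #|A|)%N &&
    ((plus%:R + #|B|%:R) / #|A|%:R <= q))).
Qed.

Lemma fin_measurable_thr_min (V : T -> 'I_p -> R) k :
  (forall k, measurable_fun setT (V ^~ k)) ->
  fin_measurable (fun x => thr_min plus q (V x) k).
Proof.
move=> mV; rewrite /thr_min.
have mN i : measurable_fun setT (fun x => `|V x i|) by exact: measurableT_comp.
apply: fin_measurable_comp2; first exact: fin_measurable_thr_ok.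
apply: fin_measurable_forall => k'.
apply: (fin_measurable_comp2 implb); first exact: fin_measurable_thr_ok.
by apply: fin_measurable_bool; exact: measurable_fun_ler.
Qed.

Lemma fin_measurable_selected (V : T -> 'I_p -> R) :
  (forall k, measurable_fun setT (V ^~ k)) ->
  fin_measurable (fun x => selected plus q (V x)).
Proof.
move=> mV; rewrite (_ : (fun x => _) = fun x =>
    [set j | [exists k, thr_min plus q (V x) k && (`|V x k| <= V x j)]]%SET); last first.
  apply/funext => x; apply/setP => j; rewrite !finset.inE.
  by apply: eq_existsb => k; rewrite /thr_min andbA.
apply: fin_measurable_set => j; apply: fin_measurable_exists => k.
apply: fin_measurable_comp2; first exact: fin_measurable_thr_min.
by apply: fin_measurable_bool; apply: measurable_fun_ler => //; exact: measurableT_comp.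
Qed.

Lemma fin_measurable_neg_selected (V : T -> 'I_p -> R) :
  (forall k, measurable_fun setT (V ^~ k)) ->
  fin_measurable (fun x => neg_selected plus q (V x)).
Proof.
move=> mV; apply: fin_measurable_set => j; apply: fin_measurable_exists => k.
apply: fin_measurable_comp2; first exact: fin_measurable_thr_min.
apply: fin_measurable_bool; apply: measurable_fun_ler => //.
by apply: measurableT_comp => //; exact: measurableT_comp.
Qed.

Lemma measurable_weight (V : T -> 'I_p -> R) j :
  (forall k, measurable_fun setT (V ^~ k)) ->
  measurable_fun setT (fun x => weight plus q j (V x)).
Proof.
move=> mV.
have mA k : measurable_fun setT (fun x => abs_at j (V x) k).
  by rewrite /abs_at; case: (k == j) => //; exact: measurableT_comp.
exact: (fin_measurable_fun
  (fun u : {set 'I_p} * {set 'I_p} => (j \in u.1)%:R / (1 + #|u.2|%:R) : R)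
  (fin_measurable_pair (fin_measurable_selected mA) (fin_measurable_neg_selected mA))).
Qed.

End selected.

End finite_valued.

(** * False discovery rate *)

Section refmeas.
Context (R : realType) (disc : bool).
Local Open Scope ereal_scope.

Let ref : set R -> \bar R := refmeas disc.

Let ref0 : ref set0 = 0.
Proof. by rewrite /ref /refmeas; case: disc; exact: measure0. Qed.

Let ref_ge0 A : 0 <= ref A.
Proof. by rewrite /ref /refmeas; case: disc; exact: measure_ge0. Qed.

Let ref_sigma_additive : semi_sigma_additive ref.
Proof.
rewrite /ref /refmeas; case: disc; first exact: measure_semi_sigma_additive.
exact: (@measure_semi_sigma_additive _ _ _ (@lebesgue_measure R)).
Qed.

HB.instance Definition _ := isMeasure.Build _ _ _ (@refmeas R disc)
  ref0 ref_ge0 ref_sigma_additive.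

End refmeas.

Section main.
Context (R : realType) (p n : nat) (q : R) (disc : 'I_p -> bool).
Hypothesis q0 : 0 < q.
Variable PXY : probability (p.-tuple R * R)%type R.
Variables Pc Qc : 'I_p -> R -> p.-tuple R -> R.
Hypothesis hP : forall j, cond_pdf (refmeas (disc j)) j (Pc j).
Hypothesis hPX : forall j,
  is_cond_pdf_of (pushforward PXY fst) (refmeas (disc j)) j (Pc j).
Hypothesis hQ : forall j, cond_pdf (refmeas (disc j)) j (Qc j).
Hypothesis hsupp : forall j t x, 0 < Pc j t x <-> 0 < Qc j t x.
Variable K : R.-pker (p.-tuple R) ~> (p.-tuple R).
Hypothesis hK : forall j, pairwise_exchangeable K (refmeas (disc j)) j (Qc j).
Context (d : measure_display) (Omega : measurableType d) (P : probability Omega R).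
Variable Z : 'I_n -> Omega -> krow R p.
Hypothesis hZ : knockoff_data P PXY K Z.
Variable w : n.-tuple (krow R p) -> 'I_p -> R.
Hypothesis hw : flip_sign w.
Hypothesis mw : forall j, measurable_fun setT (fun D => w D j).

Local Notation W om := (w (data_of Z om)).
Local Notation KL j om := (KLhat Pc Qc j (data_of Z om)).
Local Notation H0 := (nulls PXY).

Let mlr j : measurable_fun setT (log_ratio j (Pc j) (Qc j)).
Proof.
exact: (measurable_log_ratio (nu := refmeas (disc j)) (hP j) (hQ j)).
Qed.

Let mKL j : measurable_fun setT (KLhat (n := n) Pc Qc j).
Proof.
apply: measurable_sum => i.
exact: (measurableT_comp (mlr j) (measurable_tnth i)).
Qed.

Let mW j : measurable_fun setT (fun om => W om j).
Proof. exact: (measurableT_comp (mw j) (measurable_data_of hZ)). Qed.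

Let mKLom j : measurable_fun setT (fun om => KL j om).
Proof. exact: (measurableT_comp (mKL j) (measurable_data_of hZ)). Qed.

Let row_le j : j \in H0 -> forall F : krow R p -> \bar R, measurable_fun setT F ->
  (forall r, 0 <= F r)%E ->
  (row_mean PXY K F <= row_mean PXY K (fun r => F (swap_row [set j]%SET r) *
     (expR (log_ratio j (Pc j) (Qc j) (swap_row [set j]%SET r)))%:E))%E.
Proof.
rewrite finset.inE => /asboolP[kappa [kupd hkappa]] F mF F0.
exact: (row_mean_swap_le (nu := refmeas (disc j)) (hP j) (hQ j) (hsupp j)
  (hPX j) (@hK j) kupd hkappa mF F0).
Qed.

Section level.
Variables (plus : bool) (eps : R).
Local Notation S om := (selected plus q (W om)).
Local Notation wt := (weight plus q).

Let mterm j : measurable_fun setT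
  (fun om => ((KL j om <= eps)%R%:R * (0 < W om j)%R%:R * wt j (W om))%:E : \bar R).
Proof.
apply/measurable_EFinP; apply: measurable_funM; first apply: measurable_funM.
- by apply: measurable_bool_natr; apply: measurable_fun_ler => //; exact: measurable_cst.
- by apply: measurable_bool_natr; apply: measurable_fun_ltr => //; exact: measurable_cst.
- exact: measurable_weight.
Qed.

Let mneg j : measurable_fun setT
  (fun om => ((W om j < 0)%R%:R * wt j (W om))%:E : \bar R).
Proof.
apply/measurable_EFinP; apply: measurable_funM; last exact: measurable_weight.
by apply: measurable_bool_natr; apply: measurable_fun_ltr => //; exact: measurable_cst.
Qed.

Lemma abs_at_swap (j : 'I_p) (D : n.-tuple (krow R p)) :
  abs_at j (w (swap_data [set j]%SET D)) = abs_at j (w D).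
Proof.
apply/funext => k; rewrite /abs_at hw finset.in_set1; case: eqP => //= _.
by rewrite normrN.
Qed.

Lemma null_weight_le (j : 'I_p) : j \in H0 ->
  (\int[P]_om ((KL j om <= eps)%R%:R * (0 < W om j)%R%:R * wt j (W om))%:E <=
   (expR eps)%:E * \int[P]_om ((W om j < 0)%R%:R * wt j (W om))%:E)%E.
Proof.
move=> jH.
pose F (D : n.-tuple (krow R p)) : \bar R :=
  ((KLhat Pc Qc j D <= eps)%R%:R * (0 < w D j)%R%:R * wt j (w D))%:E.
have mF : measurable_fun setT F.
  apply/measurable_EFinP; apply: measurable_funM; first apply: measurable_funM.
  - by apply: measurable_bool_natr; apply: measurable_fun_ler => //; exact: measurable_cst.
  - by apply: measurable_bool_natr; apply: measurable_fun_ltr => //; exact: measurable_cst.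
  - exact: measurable_weight.
have F0 D : (0 <= F D)%E by rewrite lee_fin mulr_ge0 ?mulr_ge0// weight_ge0.
have neg0 om : (0 <= ((W om j < 0)%R%:R * wt j (W om))%:E :> \bar R)%E.
  by rewrite lee_fin mulr_ge0// weight_ge0.
apply: (le_trans (integral_swap_data hZ (mlr j) (row_le jH) mF F0)).
rewrite -ge0_integralZl ?lee_fin ?expR_ge0//.
have mG : measurable_fun setT (fun D : n.-tuple (krow R p) => swap_data [set j]%SET D).
  apply/measurable_fun_tnthP => i.
  rewrite (_ : _ \o _ = fun D => swap_row [set j]%SET (tnth D i)); last first.
    by apply/funext => D /=; rewrite tnth_mktuple.
  exact: (measurableT_comp (@measurable_swap_row1 R p j) (measurable_tnth i)).
have mGom := measurableT_comp mG (measurable_data_of hZ).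
apply: ge0_le_integral => //.
- by move=> om _; rewrite mule_ge0// lee_fin expR_ge0.
- apply: emeasurable_funM; first exact: (measurableT_comp mF mGom).
  apply/measurable_EFinP; apply: (measurableT_comp (@measurable_expR R)).
  exact: (measurableT_comp (mKL j) mGom).
- exact: measurable_funeM.
move=> om _; rewrite /F -!EFinM lee_fin /weight abs_at_swap -/(weight plus q j (W om)).
rewrite hw finset.in_set1 eqxx oppr_gt0 [leRHS]mulrC.
set kl := KLhat _ _ _ _; have [KLe|KLe] := leP kl eps; last first.
  by rewrite !mul0r mulr_ge0 ?expR_ge0// mulr_ge0// weight_ge0.
by rewrite mul1r ler_wpM2l ?ler_expR// mulr_ge0// weight_ge0.
Qed.

Local Notation den om :=
  (if plus then (maxn #|S om| 1)%:R else #|S om|%:R + q^-1 : R).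

Lemma false_le om :
  #|[pred j : 'I_p | [&& j \in S om, j \in H0 & KL j om <= eps]]|%:R / den om <=
  q * \sum_(j in H0) ((KL j om <= eps)%R%:R * (0 < W om j)%R%:R * wt j (W om)).
Proof.
apply: (le_trans (ratio_le q0 _)).
  by apply: subset_leq_card; apply/fintype.subsetP => j; rewrite !finset.inE => /andP[].
rewrite ler_pM2l//.
have -> : #|[pred j : 'I_p | [&& j \in S om, j \in H0 & KL j om <= eps]]|%:R =
    \sum_(j | [&& j \in S om, j \in H0 & KL j om <= eps]) 1 :> R.
  by rewrite -sum1_card natr_sum.
rewrite mulr_suml big_mkcond [leRHS]big_mkcond; apply: ler_sum => j _.
case: (j \in H0); rewrite ?andbF//= selected_abs_at.
have [Wj|_] := ltP 0 (W om j) => /=; last by rewrite mulr0 mul0r.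
rewrite mulr1 /weight (abs_at_id (ltW Wj)).
case: (j \in S om) => /=; last by rewrite mul0r mulr0.
by case: (KL j om <= eps); rewrite /= ?mul0r ?mul1r ?lexx.
Qed.

Lemma fin_measurable_KL :
  fin_measurable (fun om => [set j | KL j om <= eps]%SET).
Proof.
apply: fin_measurable_set => j; apply: fin_measurable_bool.
by apply: measurable_fun_ler => //; exact: measurable_cst.
Qed.

Let mSKL : fin_measurable (fun om => (S om, [set j | KL j om <= eps]%SET)).
Proof.
by apply: fin_measurable_pair; [exact: fin_measurable_selected|exact: fin_measurable_KL].
Qed.

Lemma measurable_false_ratio : measurable_fun setT (fun om =>
  (#|[pred j : 'I_p | [&& j \in S om, j \in H0 & KL j om <= eps]]|%:R / den om)%:E : \bar R).
Proof.
apply/measurable_EFinP.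
pose h (u : {set 'I_p} * {set 'I_p}) : R :=
  #|[pred j : 'I_p | [&& j \in u.1, j \in H0 & j \in u.2]]|%:R /
  (if plus then (maxn #|u.1| 1)%:R else #|u.1|%:R + q^-1).
rewrite (_ : (fun om => _) = (fun om => h (S om, [set j | KL j om <= eps]%SET))).
  exact: (fin_measurable_fun h mSKL).
apply/funext => om /=; congr (_%:R / _); apply: eq_card => j.
rewrite -[LHS]/([&& j \in S om, j \in H0 & KL j om <= eps]).
rewrite -[RHS]/([&& j \in S om, j \in H0 & j \in [set j | KL j om <= eps]%SET]).
by congr [&& _, _ & _]; rewrite finset.inE.
Qed.

Lemma false_ratio_ge0 om (c : nat) : 0 <= c%:R / den om.
Proof.
by rewrite divr_ge0//; case: plus => //; rewrite addr_ge0// invr_ge0 ltW.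
Qed.

Lemma knockoff_le :
  (\int[P]_om (#|[pred j : 'I_p | [&& j \in S om, j \in H0 & KL j om <= eps]]|%:R /
     den om)%:E <= (q * expR eps)%:E)%E.
Proof.
have t0 j om :
    (0 <= ((KL j om <= eps)%R%:R * (0 < W om j)%R%:R * wt j (W om))%:E :> \bar R)%E.
  by rewrite lee_fin mulr_ge0 ?mulr_ge0// weight_ge0.
have n0 j om : (0 <= ((W om j < 0)%R%:R * wt j (W om))%:E :> \bar R)%E.
  by rewrite lee_fin mulr_ge0// weight_ge0.
apply: (@le_trans _ _ (\int[P]_om (q%:E * \sum_(j <- enum H0)
    ((KL j om <= eps)%R%:R * (0 < W om j)%R%:R * wt j (W om))%:E))%E).
  apply: ge0_le_integral => //.
  - by move=> om _; rewrite lee_fin false_ratio_ge0.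
  - exact: measurable_false_ratio.
  - by apply: measurable_funeM; apply: emeasurable_sum => j; exact: mterm.
  - by move=> om _; rewrite sumEFin -EFinM lee_fin big_enum false_le.
rewrite ge0_integralZl//; last 3 first.
- by apply: emeasurable_sum => j; exact: mterm.
- by move=> om _; exact: sume_ge0.
- by rewrite lee_fin ltW.
rewrite EFinM lee_wpmul2l ?lee_fin ?(ltW q0)//.
rewrite ge0_integral_sum//.
apply: (@le_trans _ _ (\sum_(j <- enum H0) ((expR eps)%:E *
    \int[P]_om ((W om j < 0)%R%:R * wt j (W om))%:E))%E).
  by rewrite !big_enum; apply: lee_sum => j; exact: null_weight_le.
rewrite -ge0_sume_distrr; last by move=> j _; exact: integral_ge0.
rewrite -[leRHS]mule1 lee_wpmul2l ?lee_fin ?expR_ge0//.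
rewrite -ge0_integral_sum//.
rewrite -[leRHS](probability_setT P) -[leRHS]mul1e -integral_cst//.
apply: ge0_le_integral => //.
- by move=> om _; exact: sume_ge0.
- exact: emeasurable_sum.
move=> om _; rewrite sumEFin lee_fin big_enum/=; apply: le_trans (sum_neg_weight_le1 plus q (W om)).
rewrite [leRHS](bigID [in H0])/= lerDl; apply: sumr_ge0 => j _.
by rewrite -lee_fin.
Qed.

Lemma knockoff_fdr_le :
  (\int[P]_om (#|S om :&: H0|%:R / den om)%:E <=
   (q * expR eps)%:E + P [set om | exists2 j, j \in H0 & (eps < KL j om)%R])%E.
Proof.
pose B := [set om | exists2 j, j \in H0 & (eps < KL j om)%R].
have mB : measurable B.
  have := fin_measurable_preimage
    (fun A : {set 'I_p} => exists2 j, j \in H0 & j \notin A) fin_measurable_KL.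
  congr measurable; apply/seteqP; split => om [j jH h]; exists j => //.
    by move: h; rewrite finset.inE -ltNge.
  by rewrite finset.inE -ltNge.
rewrite -/B -[B]setIT -integral_indic//.
apply: (le_trans _ (leeD2r _ knockoff_le)).
rewrite -ge0_integralD//; last 3 first.
- by move=> om _; rewrite lee_fin false_ratio_ge0.
- exact: measurable_false_ratio.
- exact: measurable_EFin_indic.
apply: ge0_le_integral => //.
- by move=> om _; rewrite lee_fin false_ratio_ge0.
- apply/measurable_EFinP.
  exact: (fin_measurable_fun (fun A : {set 'I_p} => #|A :&: H0|%:R /
    (if plus then (maxn #|A| 1)%:R else #|A|%:R + q^-1 : R))
    (fin_measurable_selected plus q mW)).
- by apply: emeasurable_funD; [exact: measurable_false_ratio|exact: measurable_EFin_indic].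
move=> om _; rewrite -EFinD lee_fin indicE.
have [/set_mem omB|omB] := boolP (om \in B).
  rewrite (le_trans (_ : _ <= 1))//; last by rewrite lerDr false_ratio_ge0.
  have SH : (#|S om :&: H0| <= #|S om|)%N by apply: subset_leq_card; exact: subsetIl.
  case: plus SH => SH.
    by rewrite ler_pdivrMr ?mul1r ?ltr0n ?leq_max ?orbT// ler_nat leq_max SH.
  rewrite ler_pdivrMr ?mul1r; last by rewrite ltr_wpDl// invr_gt0.
  rewrite (le_trans (_ : _ <= #|selected false q (W om)|%:R)) ?ler_nat//.
  by rewrite lerDl invr_ge0 ltW.
rewrite addr0 le_eqVlt; apply/orP; left; apply/eqP; congr (_%:R / _).
apply: eq_card => j; rewrite finset.in_setI.
rewrite -[RHS]/([&& j \in S om, j \in H0 & KL j om <= eps]).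
have [jS|] //= := boolP (j \in S om); case: (boolP (j \in H0)) => //= jH.
apply/esym; rewrite leNgt; apply/negP => h; move/negP: omB; apply.
by apply/mem_set; exists j.
Qed.

End level.

End main.

Theorem theorem1
  (R : realType) (p n : nat) (q : R) (hq0 : 0 < q) (hq1 : q < 1)
  (disc : 'I_p -> bool)
  (PXY : probability (p.-tuple R * R)%type R)
  (Pc Qc : 'I_p -> R -> p.-tuple R -> R)
  (hP : forall j, cond_pdf (refmeas (disc j)) j (Pc j))
  (hPX : forall j, is_cond_pdf_of (pushforward PXY fst) (refmeas (disc j)) j (Pc j))
  (hQ : forall j, cond_pdf (refmeas (disc j)) j (Qc j))
  (hsupp : forall j t x, 0 < Pc j t x <-> 0 < Qc j t x)
  (K : R.-pker (p.-tuple R) ~> (p.-tuple R))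
  (hK : forall j, pairwise_exchangeable K (refmeas (disc j)) j (Qc j))
  (d : measure_display) (Omega : measurableType d) (P : probability Omega R)
  (Z : 'I_n -> Omega -> krow R p) (hZ : knockoff_data P PXY K Z)
  (w : n.-tuple (krow R p) -> 'I_p -> R) (hw : flip_sign w)
  (mw : forall j, measurable_fun setT (fun D => w D j)) :
  let W := fun om => w (data_of Z om) in
  let KL := fun j om => KLhat Pc Qc j (data_of Z om) in
  let H0 := nulls PXY in
  let S := fun (plus : bool) om => selected plus q (W om) in
  let bound := ereal_inf [set ((q * expR e)%:E +
                   P [set om | exists2 j, j \in H0 & (e < KL j om)%R])%E
                 | e in [set e : R | 0 <= e]] in
  (* (i) knockoff+ *)
  ((forall eps : R, 0 <= eps ->
     (\int[P]_om
        ((#|[pred j : 'I_p | [&& j \in S true om, j \in H0 & KL j om <= eps]]|%:R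
          / (maxn #|S true om| 1)%:R)%:E) <= (q * expR eps)%:E)%E) /\
   (\int[P]_om
      ((#|S true om :&: H0|%:R / (maxn #|S true om| 1)%:R)%:E) <= bound)%E) /\
  (* (ii) knockoff *)
  ((forall eps : R, 0 <= eps ->
     (\int[P]_om
        ((#|[pred j : 'I_p | [&& j \in S false om, j \in H0 & KL j om <= eps]]|%:R
          / (#|S false om|%:R + q^-1))%:E) <= (q * expR eps)%:E)%E) /\
   (\int[P]_om
      ((#|S false om :&: H0|%:R / (#|S false om|%:R + q^-1))%:E) <= bound)%E).
Proof.
move=> W KL H0 S bound.
have le plus eps := knockoff_le hq0 hP hPX hQ hsupp hK hZ hw mw plus eps.
have fdr plus eps := knockoff_fdr_le hq0 hP hPX hQ hsupp hK hZ hw mw plus eps.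
split; split.
- by move=> eps _; exact: (le true).
- by apply: le_ereal_inf_tmp => _ [eps _ <-]; exact: (fdr true).
- by move=> eps _; exact: (le false).
- by apply: le_ereal_inf_tmp => _ [eps _ <-]; exact: (fdr false).
Qed.
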